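(* Let $\{\lambda_\ell^c\}_{\ell\ge0}$ and $\{\lambda_\ell^s\}_{\ell\ge1}$ be the even and odd eigenvalues of the problem $$-\psi^{(6)}=\lambda^6\psi\ \text{ on }[-1,1],\qquad \psi(\pm1)=\psi'(\pm1)=\psi^{(5)}(\pm1)=0,$$ and let $\{\mu_\ell^c\}_{\ell\ge0}$ and $\{\mu_\ell^s\}_{\ell\ge1}$ be those of its adjoint problem $$-\phi^{(6)}=\mu^6\phi\ \text{ on }[-1,1],\qquad \phi'(\pm1)=\phi''(\pm1)=\phi'''(\pm1)=0,$$ where $\lambda_\ell^c=\mu_\ell^c$ for all $\ell\ge0$ and $\lambda_\ell^s=\mu_\ell^s$ for all $\ell\ge1$. Then the corresponding eigenfunctions $\psi_\ell^c,\psi_\ell^s,\phi_\ell^c,\phi_\ell^s$ (given explicitly in the context) satisfy the biorthogonality relations $$\langle\psi_\ell^c,\phi_m^c\rangle=\begin{cases}0&\text{if }\ell\ne m\\ c_m\ne0&\text{if }\ell=m\end{cases}\quad(\ell,m\ge0),\qquad \langle\psi_\ell^s,\phi_m^s\rangle=\begin{cases}0&\text{if }\ell\ne m\\ s_m\ne0&\text{if }\ell=m\end{cases}\quad(\ell,m\ge1),$$ where $c_0=\int_{-1}^{1}(x^4-2x^2+1)\,\mathrm{d}x=16/15$ and, for $m\ge1$, writing $\lambda=\lambda_m^c$, $$\begin{aligned}c_m={}&\frac{\csc^2\frac{\lambda}{2}\,\operatorname{sech}^2\frac{\sqrt3\lambda}{2}}{24\lambda\left(\sqrt3\sin\lambda-\sinh(\sqrt3\lambda)\right)\left(1+\cot^2\frac{\lambda}{2}\tanh^2\frac{\sqrt3\lambda}{2}\right)}\\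 &\times\Big[4\sqrt3\cos^2\lambda\,\cosh(2\sqrt3\lambda)-2\sqrt3\cosh(\sqrt3\lambda)\big(-18\lambda\sin\lambda+7\cos\lambda+\cos3\lambda\big)\\ &\quad-2\sqrt3\big(9\lambda\sin2\lambda-7\cos2\lambda+\cos4\lambda\big)+6\sinh(\sqrt3\lambda)\big(7\sin\lambda-\sin3\lambda+2\lambda\cos3\lambda\big)\\ &\quad-6\big(\lambda+\sin2\lambda\big)\sinh(2\sqrt3\lambda)\Big],\end{aligned}$$ and, for $m\ge1$, writing $\lambda=\lambda_m^s$, $$\begin{aligned}s_m={}&-\frac{\operatorname{csch}\frac{\sqrt3\lambda}{2}\,\operatorname{sech}\frac{\sqrt3\lambda}{2}}{12\lambda\left(\cos\lambda+\cosh(\sqrt3\lambda)\right)}\\ &\times\Big[-2\sqrt3\cos2\lambda\,\cosh^2(\sqrt3\lambda)+\sqrt3\sin2\lambda\,\cosh(\sqrt3\lambda)\big(2\sin\lambda-3\lambda\cos\lambda\big)\\ &\quad+\sqrt3\big(3\lambda\sin2\lambda+\cos4\lambda+\cosh(2\sqrt3\lambda)\big)+6\lambda\cos^3\lambda\,\sinh(\sqrt3\lambda)-3\lambda\sinh(2\sqrt3\lambda)\Big].\end{aligned}$$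
   Context: $\langle f,g\rangle=\int_{-1}^{1}f(x)g(x)\,\mathrm{d}x$. Eigenvalues. The even eigenvalues (those with even eigenfunctions) of both problems are $\lambda_0^c=\mu_0^c=0$ and, for $m\ge1$, $\lambda_m^c=\mu_m^c$, the $m$-th positive root (in increasing order) of $$\cos(2\lambda)+2\cos\lambda\cosh(\sqrt3\lambda)-3=0.$$ The odd eigenvalues (those with odd eigenfunctions) of both problems are the positive roots of $\sin\lambda\,(\cos\lambda-\cosh(\sqrt3\lambda))=0$, i.e. $\lambda_m^s=\mu_m^s=m\pi$, $m\ge1$. Eigenfunctions of the first problem. $\psi_0^c(x)=x^4-2x^2+1$. For $m\ge1$, with $\lambda=\lambda_m^c$, $$\begin{aligned}\psi_m^c(x)={}&\cos\lambda x+\frac{\cos\frac{\lambda}{2}\cosh\frac{\sqrt3\lambda}{2}}{\sqrt3\sin\lambda-\sinh(\sqrt3\lambda)}\Big[\Big(-2\sqrt3\cos\lambda\tan\tfrac{\lambda}{2}-2(\cos\lambda-2)\tanh\tfrac{\sqrt3\lambda}{2}\Big)\cos\tfrac{\lambda x}{2}\cosh\tfrac{\sqrt3\lambda x}{2}\\ &+\Big(-3\tan\tfrac{\lambda}{2}+\sin^2\tfrac{\lambda}{2}\tan\tfrac{\lambda}{2}-\tfrac32\sin\lambda+2\sqrt3\cos\lambda\tanh\tfrac{\sqrt3\lambda}{2}\Big)\sin\tfrac{\lambda x}{2}\sinh\tfrac{\sqrt3\lambda x}{2}\Big].\end{aligned}$$ For $m\ge1$, with $\lambda=\lambda_m^s$,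 $$\psi_m^s(x)=\sin\lambda x-\frac{4}{\sinh(\sqrt3\lambda)}\Big[\cos^3\tfrac{\lambda}{2}\sinh\tfrac{\sqrt3\lambda}{2}\,\sin\tfrac{\lambda x}{2}\cosh\tfrac{\sqrt3\lambda x}{2}+\sin^3\tfrac{\lambda}{2}\cosh\tfrac{\sqrt3\lambda}{2}\,\cos\tfrac{\lambda x}{2}\sinh\tfrac{\sqrt3\lambda x}{2}\Big].$$ Eigenfunctions of the adjoint problem. $\phi_0^c(x)=1$. For $m\ge1$, with $\mu=\mu_m^c$, $$\begin{aligned}\phi_m^c(x)={}&\cos\mu x+\frac{2\sin\mu\left(\cos\frac{\mu}{2}\sinh\frac{\sqrt3\mu}{2}-\sqrt3\sin\frac{\mu}{2}\cosh\frac{\sqrt3\mu}{2}\right)}{\cos\mu-\cosh(\sqrt3\mu)}\sin\tfrac{\mu x}{2}\sinh\tfrac{\sqrt3\mu x}{2}\\ &+\frac{\csc\frac{\mu}{2}\operatorname{sech}\frac{\sqrt3\mu}{2}\sin\mu\left(\sqrt3\cot\frac{\mu}{2}\tanh\frac{\sqrt3\mu}{2}+1\right)}{1+\cot^2\frac{\mu}{2}\tanh^2\frac{\sqrt3\mu}{2}}\cos\tfrac{\mu x}{2}\cosh\tfrac{\sqrt3\mu x}{2}.\end{aligned}$$ For $m\ge1$, with $\mu=\mu_m^s$, $$\begin{aligned}\phi_m^s(x)={}&\sin\mu x+\frac{2\cos\mu\left(\cos\frac{\mu}{2}\cosh\frac{\sqrt3\mu}{2}-\sqrt3\sin\frac{\mu}{2}\sinh\frac{\sqrt3\mu}{2}\right)}{\cos\mu+\cosh(\sqrt3\mu)}\sin\tfrac{\mu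 x}{2}\cosh\tfrac{\sqrt3\mu x}{2}\\ &-\frac{\cos\mu\,\operatorname{csch}\frac{\sqrt3\mu}{2}\left(\sin\frac{\mu}{2}+\sqrt3\cos\frac{\mu}{2}\coth\frac{\sqrt3\mu}{2}\right)}{\sin^2\frac{\mu}{2}+\cos^2\frac{\mu}{2}\coth^2\frac{\sqrt3\mu}{2}}\cos\tfrac{\mu x}{2}\sinh\tfrac{\sqrt3\mu x}{2}.\end{aligned}$$ *)

(* Defs.v *)
From Stdlib Require Import Reals List.
From Coquelicot Require Import Coquelicot.
Import ListNotations.
Open Scope R_scope.

Definition inner (f g : R -> R) : R := RInt (fun x => f x * g x) (-1) 1.

(* [bc] lists the orders of the derivatives that must vanish at both endpoints.
   Functions are six times differentiable on the whole line while the equation,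
   the boundary conditions and non-triviality only concern [-1, 1]: a function
   six times continuously differentiable on [-1, 1] (one-sidedly at the
   endpoints) extends to such a function by its Taylor polynomials at -1 and 1,
   so this is the usual notion of a classical solution on [-1, 1]. *)
Definition is_eigenfunction (bc : list nat) (lam : R) (f : R -> R) : Prop :=
  (forall (k : nat) (x : R), (k <= 6)%nat -> ex_derive_n f k x) /\
  (exists x, -1 <= x <= 1 /\ f x <> 0) /\
  (forall x, -1 <= x <= 1 -> - Derive_n f 6 x = lam ^ 6 * f x) /\
  (forall k, In k bc -> Derive_n f k (-1) = 0 /\ Derive_n f k 1 = 0).

Definition first_bc : list nat := [0; 1; 5]%nat.
Definition adjoint_bc : list nat := [1; 2; 3]%nat.

Definition even_function (f : R -> R) : Prop :=
  forall x, -1 <= x <= 1 -> f (- x) = f x.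
Definition odd_function (f : R -> R) : Prop :=
  forall x, -1 <= x <= 1 -> f (- x) = - f x.

(* Only [lam ^ 6] enters the equation; the representative [0 <= lam] is used. *)
Definition even_eigenvalue (bc : list nat) (lam : R) : Prop :=
  0 <= lam /\ exists f, is_eigenfunction bc lam f /\ even_function f.
Definition odd_eigenvalue (bc : list nat) (lam : R) : Prop :=
  0 <= lam /\ exists f, is_eigenfunction bc lam f /\ odd_function f.

(* [u k0 < u (k0 + 1) < ...] lists exactly the reals satisfying [P]; the values
   of [u] at indices below [k0] are irrelevant. *)
Definition increasing_enumeration (k0 : nat) (P : R -> Prop) (u : nat -> R) : Prop :=
  (forall l m, (k0 <= l)%nat -> (l < m)%nat -> u l < u m) /\
  (forall x, P x <-> exists m, (k0 <= m)%nat /\ u m = x).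

Definition csc (x : R) : R := / sin x.
Definition cot (x : R) : R := cos x / sin x.
Definition sech (x : R) : R := / cosh x.
Definition csch (x : R) : R := / sinh x.
Definition coth (x : R) : R := cosh x / sinh x.

Definition psi_c (m : nat) (l x : R) : R :=
  match m with
  | O => x ^ 4 - 2 * x ^ 2 + 1
  | S _ =>
    cos (l * x)
    + cos (l / 2) * cosh (sqrt 3 * l / 2) / (sqrt 3 * sin l - sinh (sqrt 3 * l))
      * ((- 2 * sqrt 3 * cos l * tan (l / 2)
          - 2 * (cos l - 2) * tanh (sqrt 3 * l / 2))
         * cos (l * x / 2) * cosh (sqrt 3 * l * x / 2)
         + (- 3 * tan (l / 2) + (sin (l / 2)) ^ 2 * tan (l / 2)
            - 3 / 2 * sin l + 2 * sqrt 3 * cos l * tanh (sqrt 3 * l / 2))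
           * sin (l * x / 2) * sinh (sqrt 3 * l * x / 2))
  end.

Definition psi_s (l x : R) : R :=
  sin (l * x)
  - 4 / sinh (sqrt 3 * l)
    * ((cos (l / 2)) ^ 3 * sinh (sqrt 3 * l / 2)
       * sin (l * x / 2) * cosh (sqrt 3 * l * x / 2)
       + (sin (l / 2)) ^ 3 * cosh (sqrt 3 * l / 2)
         * cos (l * x / 2) * sinh (sqrt 3 * l * x / 2)).

Definition phi_c (m : nat) (mu x : R) : R :=
  match m with
  | O => 1
  | S _ =>
    cos (mu * x)
    + 2 * sin mu * (cos (mu / 2) * sinh (sqrt 3 * mu / 2)
                    - sqrt 3 * sin (mu / 2) * cosh (sqrt 3 * mu / 2))
      / (cos mu - cosh (sqrt 3 * mu))
      * sin (mu * x / 2) * sinh (sqrt 3 * mu * x / 2)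
    + csc (mu / 2) * sech (sqrt 3 * mu / 2) * sin mu
      * (sqrt 3 * cot (mu / 2) * tanh (sqrt 3 * mu / 2) + 1)
      / (1 + (cot (mu / 2)) ^ 2 * (tanh (sqrt 3 * mu / 2)) ^ 2)
      * cos (mu * x / 2) * cosh (sqrt 3 * mu * x / 2)
  end.

Definition phi_s (mu x : R) : R :=
  sin (mu * x)
  + 2 * cos mu * (cos (mu / 2) * cosh (sqrt 3 * mu / 2)
                  - sqrt 3 * sin (mu / 2) * sinh (sqrt 3 * mu / 2))
    / (cos mu + cosh (sqrt 3 * mu))
    * sin (mu * x / 2) * cosh (sqrt 3 * mu * x / 2)
  - cos mu * csch (sqrt 3 * mu / 2)
    * (sin (mu / 2) + sqrt 3 * cos (mu / 2) * coth (sqrt 3 * mu / 2))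
    / ((sin (mu / 2)) ^ 2 + (cos (mu / 2)) ^ 2 * (coth (sqrt 3 * mu / 2)) ^ 2)
    * cos (mu * x / 2) * sinh (sqrt 3 * mu * x / 2).

Definition c_const (m : nat) (l : R) : R :=
  match m with
  | O => RInt (fun x => x ^ 4 - 2 * x ^ 2 + 1) (-1) 1
  | S _ =>
    (csc (l / 2)) ^ 2 * (sech (sqrt 3 * l / 2)) ^ 2
    / (24 * l * (sqrt 3 * sin l - sinh (sqrt 3 * l))
       * (1 + (cot (l / 2)) ^ 2 * (tanh (sqrt 3 * l / 2)) ^ 2))
    * (4 * sqrt 3 * (cos l) ^ 2 * cosh (2 * sqrt 3 * l)
       - 2 * sqrt 3 * cosh (sqrt 3 * l)
         * (- 18 * l * sin l + 7 * cos l + cos (3 * l))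
       - 2 * sqrt 3 * (9 * l * sin (2 * l) - 7 * cos (2 * l) + cos (4 * l))
       + 6 * sinh (sqrt 3 * l) * (7 * sin l - sin (3 * l) + 2 * l * cos (3 * l))
       - 6 * (l + sin (2 * l)) * sinh (2 * sqrt 3 * l))
  end.

Definition s_const (l : R) : R :=
  - (csch (sqrt 3 * l / 2) * sech (sqrt 3 * l / 2)
     / (12 * l * (cos l + cosh (sqrt 3 * l))))
  * (- 2 * sqrt 3 * cos (2 * l) * (cosh (sqrt 3 * l)) ^ 2
     + sqrt 3 * sin (2 * l) * cosh (sqrt 3 * l) * (2 * sin l - 3 * l * cos l)
     + sqrt 3 * (3 * l * sin (2 * l) + cos (4 * l) + cosh (2 * sqrt 3 * l))
     + 6 * l * (cos l) ^ 3 * sinh (sqrt 3 * l)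
     - 3 * l * sinh (2 * sqrt 3 * l)).

(* Main.v *)
Require Import Defs.
From Stdlib Require Import Reals List Lra Lia Classical.
From Coquelicot Require Import Coquelicot.
Open Scope R_scope.

(* Lagrange's identity: if [f] and [g] satisfy [- f^(6) = lam^6 f] and
   [- g^(6) = mu^6 g], the bilinear concomitant
   [f''''' g - f'''' g' + f''' g'' - f'' g''' + f' g'''' - f g''''']
   is a primitive of [(mu^6 - lam^6) f g].
   - For [lam <> mu] the two sets of boundary conditions make it vanish at both
     endpoints, whence orthogonality.
   - For [lam = mu] it is constant. Tested against explicit solutions of the same
     parity it vanishes at 0, hence at 1, and the resulting linear system for the
     boundary data of [f] is singular only at the roots of the characteristic
     equation; so the eigenvalues are found without solving the ODE.
   - The map [phi |-> - phi'' / lam^2] sends solutions of the adjoint problem to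
     solutions [psi] of the first one, and Lagrange's identity for [x psi'] and
     [phi] gives [<psi, phi> = phi''''(1)^2 / (3 lam^8)], which is nonzero. The rest
     is trigonometry modulo the characteristic equation. *)

(** * Lagrange's identity and orthogonality for distinct eigenvalues *)

(** A function listed together with its derivatives, so that closed-form solutions can be
    differentiated without evaluating [Derive_n]. *)
Definition derivative_chain (g : nat -> R -> R) : Prop :=
  forall k x, is_derive (g k) x (g (S k) x).

Definition concomitant (F g : nat -> R -> R) (x : R) : R :=
  F 5%nat x * g 0%nat x - F 4%nat x * g 1%nat x + F 3%nat x * g 2%nat x
  - F 2%nat x * g 3%nat x + F 1%nat x * g 4%nat x - F 0%nat x * g 5%nat x.

(** The product rule gives twelve terms; the alternating signs cancel all but the two extreme
    ones. *)
Lemma is_derive_concomitant (F g : nat -> R -> R) (x : R) :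
  (forall k, (k <= 5)%nat -> is_derive (F k) x (F (S k) x)) ->
  (forall k, (k <= 5)%nat -> is_derive (g k) x (g (S k) x)) ->
  is_derive (concomitant F g) x (F 6%nat x * g 0%nat x - F 0%nat x * g 6%nat x).
Proof.
intros HF Hg.
assert (prod : forall i j, (i <= 5)%nat -> (j <= 5)%nat ->
  is_derive (fun y => F i y * g j y) x (F (S i) x * g j x + F i x * g (S j) x)).
{ intros i j Hi Hj.
  exact (is_derive_mult (F i) (g j) x _ _ (HF i Hi) (Hg j Hj) Rmult_comm). }
pose proof (is_derive_minus _ _ _ _ _
  (is_derive_plus _ _ _ _ _
    (is_derive_minus _ _ _ _ _
      (is_derive_plus _ _ _ _ _
        (is_derive_minus _ _ _ _ _ (prod 5%nat 0%nat ltac:(lia) ltac:(lia))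
                                   (prod 4%nat 1%nat ltac:(lia) ltac:(lia)))
        (prod 3%nat 2%nat ltac:(lia) ltac:(lia)))
      (prod 2%nat 3%nat ltac:(lia) ltac:(lia)))
    (prod 1%nat 4%nat ltac:(lia) ltac:(lia)))
  (prod 0%nat 5%nat ltac:(lia) ltac:(lia))) as H.
match type of H with is_derive _ _ ?d =>
  replace (F 6%nat x * g 0%nat x - F 0%nat x * g 6%nat x) with d;
  [exact H | unfold minus, plus, opp; simpl; ring] end.
Qed.

Lemma derivative_chain_is_derive_n (g : nat -> R -> R) :
  derivative_chain g -> forall k x, is_derive_n (g 0%nat) k x (g k x).
Proof.
intros Hg; induction k as [|k IH]; intros x; [reflexivity|]; simpl.
apply is_derive_ext with (g k); [|apply Hg].
intros t; symmetry; apply is_derive_n_unique, IH.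
Qed.

Lemma derivative_chain_Derive_n (g : nat -> R -> R) :
  derivative_chain g -> forall k x, Derive_n (g 0%nat) k x = g k x.
Proof. intros Hg k x; apply is_derive_n_unique, derivative_chain_is_derive_n, Hg. Qed.

Lemma eigenfunction_is_derive (bc : list nat) (lam : R) (f : R -> R) :
  is_eigenfunction bc lam f -> forall k x, (k <= 5)%nat ->
  is_derive (Derive_n f k) x (Derive_n f (S k) x).
Proof.
intros [Hd _] k x Hk; apply Derive_correct.
exact (Hd (S k) x ltac:(lia)).
Qed.

(** The equation for [f] is known on [-1, 1] only, so [a] and [b] are confined there. [g] is a
    sequence of derivatives, which allows both [Derive_n h] and explicit test functions. *)
Lemma RInt_eigenfunction_mult (bc : list nat) (lam mu : R) (f : R -> R)
  (g : nat -> R -> R) (a b : R) :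
  is_eigenfunction bc lam f ->
  (forall k x, (k <= 5)%nat -> is_derive (g k) x (g (S k) x)) ->
  (forall x, -1 <= x <= 1 -> g 6%nat x = - mu ^ 6 * g 0%nat x) ->
  -1 <= a <= 1 -> -1 <= b <= 1 ->
  (mu ^ 6 - lam ^ 6) * RInt (fun x => f x * g 0%nat x) a b =
  concomitant (Derive_n f) g b - concomitant (Derive_n f) g a.
Proof.
intros Hf Hg Hg6 Ha Hb.
assert (Hfd := eigenfunction_is_derive _ _ _ Hf).
destruct Hf as [_ [_ [Hode _]]].
assert (Hc : forall x, continuous (fun x => f x * g 0%nat x) x).
{ intros x; apply (continuous_mult f (g 0%nat));
    apply (ex_derive_continuous (V := R_NormedModule)).
  - exists (Derive_n f 1 x); apply (Hfd 0%nat); lia.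
  - exists (g 1%nat x); apply Hg; lia. }
change ((mu ^ 6 - lam ^ 6) * RInt (fun x => f x * g 0%nat x) a b)
  with (scal (mu ^ 6 - lam ^ 6) (RInt (fun x => f x * g 0%nat x) a b)).
rewrite <- RInt_scal by
  (apply (ex_RInt_continuous (V := R_CompleteNormedModule)); intros; apply Hc).
apply is_RInt_unique, (is_RInt_derive (V := R_CompleteNormedModule)).
- intros x Hx.
  assert (Hx1 : -1 <= x <= 1).
  { revert Hx; unfold Rmin, Rmax; destruct (Rle_dec a b); lra. }
  pose proof (is_derive_concomitant (Derive_n f) g x
    (fun k Hk => Hfd k x Hk) (fun k Hk => Hg k x Hk)) as Hd.
  match goal with |- is_derive _ _ ?d =>
    match type of Hd with is_derive _ _ ?e => replace d with e; [exact Hd|] end end.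
  rewrite Hg6 by assumption; specialize (Hode x Hx1).
  replace (Derive_n f 6 x) with (- (lam ^ 6 * f x)) by lra.
  simpl Derive_n; unfold scal; simpl; unfold mult; simpl; ring.
- intros x _; apply (continuous_scal_r (V := R_NormedModule)), Hc.
Qed.

Lemma pow6_lt (a b : R) : 0 <= a -> a < b -> a ^ 6 < b ^ 6.
Proof.
intros Ha Hab.
assert (0 < b ^ 5) by (apply pow_lt; lra).
pose proof (pow_incr a b 5 (conj Ha (Rlt_le _ _ Hab))).
pose proof (pow_le a 5 Ha); simpl in *; nra.
Qed.

(** In each of the six products of the concomitant one factor is a vanishing boundary value.
    Distinct nonnegative [lam] and [mu] have distinct sixth powers, so the factor in front of the
    integral cancels. *)
Lemma eigenfunction_orthogonal (lam mu : R) (f h : R -> R) :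
  is_eigenfunction first_bc lam f -> is_eigenfunction adjoint_bc mu h ->
  0 <= lam -> 0 <= mu -> lam <> mu -> inner f h = 0.
Proof.
intros Hf Hh Hl Hm Hlm.
pose proof (RInt_eigenfunction_mult _ lam mu f (Derive_n h) (-1) 1 Hf
  (eigenfunction_is_derive _ _ _ Hh)) as H.
destruct Hf as [_ [_ [_ Bf]]]; destruct Hh as [_ [_ [Oh Bh]]].
destruct (Bf 0%nat) as [f0m f0p]; [simpl; auto|].
destruct (Bf 1%nat) as [f1m f1p]; [simpl; auto|].
destruct (Bf 5%nat) as [f5m f5p]; [simpl; auto|].
destruct (Bh 1%nat) as [h1m h1p]; [simpl; auto|].
destruct (Bh 2%nat) as [h2m h2p]; [simpl; auto|].
destruct (Bh 3%nat) as [h3m h3p]; [simpl; auto|].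
unfold concomitant in H.
rewrite f0m, f0p, f1m, f1p, f5m, f5p, h1m, h1p, h2m, h2p, h3m, h3p in H.
specialize (H ltac:(intros x Hx; specialize (Oh x Hx); simpl Derive_n at 2; lra)
  ltac:(lra) ltac:(lra)).
apply (Rmult_eq_reg_l (mu ^ 6 - lam ^ 6)).
- unfold inner; simpl Derive_n at 1 in H; etransitivity; [exact H | ring].
- destruct (Rdichotomy _ _ Hlm) as [h1|h1].
  + pose proof (pow6_lt lam mu Hl h1); lra.
  + pose proof (pow6_lt mu lam Hm h1); lra.
Qed.

Lemma eigenfunction_concomitant_constant (bc : list nat) (lam : R) (f : R -> R)
  (g : nat -> R -> R) :
  is_eigenfunction bc lam f ->
  (forall k x, (k <= 5)%nat -> is_derive (g k) x (g (S k) x)) ->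
  (forall x, g 6%nat x = - lam ^ 6 * g 0%nat x) ->
  forall a b, -1 <= a <= 1 -> -1 <= b <= 1 ->
  concomitant (Derive_n f) g a = concomitant (Derive_n f) g b.
Proof.
intros Hf Hg Hg6 a b Ha Hb.
pose proof (RInt_eigenfunction_mult bc lam lam f g a b Hf Hg (fun x _ => Hg6 x) Ha Hb).
lra.
Qed.

(** * Parity, Cauchy data and the boundary formula for the inner product *)

(** The sign [e] treats even and odd functions together: for [e] equal to 1 or -1, derivatives at 0
    of the wrong parity vanish. *)
Lemma Derive_n_0_parity (e : R) (f : R -> R) (k : nat) :
  (forall j x, (j <= k)%nat -> ex_derive_n f j x) ->
  (forall x, -1 <= x <= 1 -> f (- x) = e * f x) ->
  e * Derive_n f k 0 = (-1) ^ k * Derive_n f k 0.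
Proof.
intros Hd He.
rewrite <- Derive_n_scal_l.
(* Writing 0 as - 0 lets the derivative of a composition with x |-> - x appear; parity is used only
   near 0. *)
rewrite <- Ropp_0 at 2; rewrite <- Derive_n_comp_opp.
- apply Derive_n_ext_loc.
  exists (mkposreal 1 Rlt_0_1); intros t Ht; symmetry; apply He.
  apply Rabs_le_between; replace t with (minus t 0) by (unfold minus, plus, opp; simpl; ring).
  left; exact Ht.
- apply filter_forall; intros; apply Hd; assumption.
Qed.

(* If the Cauchy data of [f] at 1 vanish, then so does the constant concomitant
   of [f] with [x |-> G (x - x0)]; its value at [x0] is [- f x0 * G''''' 0]. *)
Lemma eigenfunction_Cauchy_data (bc : list nat) (lam : R) (f : R -> R) (G : nat -> R -> R) :
  is_eigenfunction bc lam f -> derivative_chain G ->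
  (forall x, G 6%nat x = - lam ^ 6 * G 0%nat x) ->
  (forall k, (k <= 4)%nat -> G k 0 = 0) -> G 5%nat 0 <> 0 ->
  ~ (forall k, (k <= 5)%nat -> Derive_n f k 1 = 0).
Proof.
intros Hf HG HG6 HG0 HG5 Hz.
destruct (proj1 (proj2 Hf)) as [x0 [Hx0 Hn]]; apply Hn.
pose proof (eigenfunction_concomitant_constant bc lam f (fun k x => G k (x - x0)) Hf) as H.
unfold concomitant in H.
assert (E := H
  ltac:(intros k x _; replace (G (S k) (x - x0)) with (scal 1 (G (S k) (x - x0)))
           by (unfold scal; simpl; unfold mult; simpl; ring);
        apply (is_derive_comp (G k) (fun x => x - x0)); [apply HG |
          auto_derive; [exact I | ring]])
  ltac:(intros; apply HG6) 1 x0 ltac:(lra) Hx0).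
rewrite !Hz in E by lia.
replace (x0 - x0) with 0 in E by ring.
rewrite !(HG0 _) in E by lia.
simpl Derive_n at 6 in E.
apply (Rmult_eq_reg_r (G 5%nat 0)); [lra | assumption].
Qed.

Lemma derivative_chain_eigenfunction (bc : list nat) (lam : R) (g : nat -> R -> R) :
  derivative_chain g -> (forall x, g 6%nat x = - lam ^ 6 * g 0%nat x) ->
  (exists x, -1 <= x <= 1 /\ g 0%nat x <> 0) ->
  (forall k, In k bc -> g k (-1) = 0 /\ g k 1 = 0) ->
  is_eigenfunction bc lam (g 0%nat).
Proof.
intros Hg H6 Hn Hbc; split; [|split; [exact Hn | split]].
- intros [|k] x _; [exact I|].
  exists (g (S k) x); exact (derivative_chain_is_derive_n g Hg (S k) x).
- intros x _; rewrite derivative_chain_Derive_n, H6 by assumption; ring.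
- intros k Hk; rewrite !derivative_chain_Derive_n by assumption; auto.
Qed.

Lemma is_eigenfunction_ext (bc : list nat) (lam : R) (f g : R -> R) :
  (forall x, f x = g x) -> is_eigenfunction bc lam f -> is_eigenfunction bc lam g.
Proof.
intros E [Hd [[x0 [Hx0 Hn]] [Ho Hb]]]; repeat split.
- intros k x Hk; apply ex_derive_n_ext with f; auto.
- exists x0; rewrite <- E; auto.
- intros x Hx; rewrite <- (Derive_n_ext f) by assumption; rewrite <- E; auto.
- rewrite <- (Derive_n_ext f) by assumption; apply Hb; assumption.
- rewrite <- (Derive_n_ext f) by assumption; apply Hb; assumption.
Qed.

(* [u = x f'] satisfies [- u^(6) = lam^6 u + 6 lam^6 f], so the concomitant of
   [u] and [h] is a primitive of [- 6 lam^6 f h]; at the endpoints only its term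
   [u' h''''] survives. *)
Lemma inner_boundary (lam : R) (f h : nat -> R -> R) :
  derivative_chain f -> derivative_chain h ->
  (forall x, f 6%nat x = - lam ^ 6 * f 0%nat x) ->
  (forall x, h 6%nat x = - lam ^ 6 * h 0%nat x) ->
  (forall x, f 7%nat x = - lam ^ 6 * f 1%nat x) ->
  (forall k, In k first_bc -> f k (-1) = 0 /\ f k 1 = 0) ->
  (forall k, In k adjoint_bc -> h k (-1) = 0 /\ h k 1 = 0) ->
  - 6 * lam ^ 6 * inner (f 0%nat) (h 0%nat) =
  f 2%nat 1 * h 4%nat 1 + f 2%nat (-1) * h 4%nat (-1).
Proof.
intros Hf Hh f6 h6 f7 Bf Bh.
(* By Leibniz' rule these are the successive derivatives of x f'. *)
set (u := fun k x => x * f (S k) x + INR k * f k x).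
assert (Hu : forall k x, is_derive (u k) x (u (S k) x)).
{ intros k x; unfold u.
  match goal with |- is_derive _ _ ?d =>
    replace d with (plus (plus (mult 1 (f (S k) x)) (mult x (f (S (S k)) x)))
                         (scal (INR k) (f (S k) x)))
      by (rewrite S_INR; unfold plus, mult, scal; simpl; unfold mult; simpl; ring) end.
  apply (is_derive_plus (V := R_NormedModule)).
  - apply (is_derive_mult (fun x => x) (f (S k)));
      [exact (is_derive_id (K := R_AbsRing) x) | apply Hf | exact Rmult_comm].
  - apply (is_derive_scal (f k)), Hf. }
assert (Hc : forall x, continuous (fun x => f 0%nat x * h 0%nat x) x).
{ intros x; apply (continuous_mult (f 0%nat) (h 0%nat));
    apply (ex_derive_continuous (V := R_NormedModule)).
  - exists (f 1%nat x); apply Hf.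
  - exists (h 1%nat x); apply Hh. }
assert (I : is_RInt (fun x => scal (- 6 * lam ^ 6) (f 0%nat x * h 0%nat x)) (-1) 1
              (minus (concomitant u h 1) (concomitant u h (-1)))).
{ apply (is_RInt_derive (V := R_CompleteNormedModule)).
  - intros x _.
    pose proof (is_derive_concomitant u h x (fun k _ => Hu k x) (fun k _ => Hh k x)) as Hd.
    match goal with |- is_derive _ _ ?d =>
      match type of Hd with is_derive _ _ ?e => replace d with e; [exact Hd|] end end.
    unfold u; rewrite f7, f6, h6; simpl INR; unfold scal; simpl; unfold mult; simpl; ring.
  - intros x _; apply (continuous_scal_r (V := R_NormedModule)), Hc. }
apply (is_RInt_unique (V := R_CompleteNormedModule)) in I.
pose proof (RInt_scal (V := R_CompleteNormedModule) (fun x => f 0%nat x * h 0%nat x) (-1) 1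
  (- 6 * lam ^ 6) (ex_RInt_continuous (V := R_CompleteNormedModule) _ _ _ (fun x _ => Hc x))) as J.
pose proof (eq_trans (eq_sym J) I) as K.
change (- 6 * lam ^ 6 * inner (f 0%nat) (h 0%nat) = concomitant u h 1 - concomitant u h (-1)) in K.
rewrite K.
destruct (Bf 0%nat) as [f0m f0p]; [simpl; auto|].
destruct (Bf 1%nat) as [f1m f1p]; [simpl; auto|].
destruct (Bf 5%nat) as [f5m f5p]; [simpl; auto|].
destruct (Bh 1%nat) as [h1m h1p]; [simpl; auto|].
destruct (Bh 2%nat) as [h2m h2p]; [simpl; auto|].
destruct (Bh 3%nat) as [h3m h3p]; [simpl; auto|].
(* At the endpoints [u 0] = x f' = 0, [u 1] = x f'' and [u 5] = x f^(6) + 5 f^(5) = 0, because f^(6)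
   = - lam^6 f. *)
unfold concomitant, u; rewrite !f6, f0m, f0p, f1m, f1p, f5m, f5p, h1m, h1p, h2m, h2p, h3m, h3p.
simpl INR; ring.
Qed.

(** Supplies the non-triviality clause of [is_eigenfunction] for both members of a pair at once. *)
Lemma inner_neq_0 (f g : R -> R) :
  inner f g <> 0 ->
  (exists x, -1 <= x <= 1 /\ f x <> 0) /\ (exists x, -1 <= x <= 1 /\ g x <> 0).
Proof.
assert (Z : forall k : R -> R, (forall x, -1 < x < 1 -> k x = 0) -> RInt k (-1) 1 = 0).
{ intros k Hk; rewrite (RInt_ext k (fun _ => 0)).
  - rewrite RInt_const; apply Rmult_0_r.
  - rewrite Rmin_left, Rmax_right by lra; exact Hk. }
intros H; split; apply NNPP; intros Hn; apply H, Z; intros x Hx.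
- destruct (Req_dec (f x) 0) as [E|E]; [rewrite E; ring|].
  exfalso; apply Hn; exists x; split; [lra | exact E].
- destruct (Req_dec (g x) 0) as [E|E]; [rewrite E; ring|].
  exfalso; apply Hn; exists x; split; [lra | exact E].
Qed.

(** Turns equality of two spectra into equality of their enumerations. By strong induction, [u l] is
    a value of [v] at an index not below [l], since at lower indices [v] agrees with [u], whose
    values there are smaller. Hence [v l <= u l], and the converse is symmetric. *)
Lemma increasing_enumeration_unique (k0 : nat) (P Q : R -> Prop) (u v : nat -> R) :
  (forall x, P x <-> Q x) ->
  increasing_enumeration k0 P u -> increasing_enumeration k0 Q v ->
  forall l, (k0 <= l)%nat -> u l = v l.
Proof.
assert (le : forall (P Q : R -> Prop) (u v : nat -> R) (l : nat),
  (forall x, P x -> Q x) ->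
  increasing_enumeration k0 P u -> increasing_enumeration k0 Q v ->
  (forall j, (j < l)%nat -> (k0 <= j)%nat -> u j = v j) -> (k0 <= l)%nat -> v l <= u l).
{ clear; intros P Q u v l PQ [iu eu] [iv ev] IH Hl.
  assert (Hu : P (u l)) by (apply eu; eauto).
  destruct (proj1 (ev _) (PQ _ Hu)) as [m [Hm E]]; rewrite <- E.
  destruct (Nat.lt_trichotomy l m) as [h|[h|h]].
  - left; auto.
  - rewrite h; lra.
  - exfalso; specialize (iu m l Hm h); rewrite (IH m h Hm) in iu; lra. }
intros PQ Hu Hv l; induction l as [l IH] using (well_founded_induction Nat.lt_wf_0); intros Hl.
apply Rle_antisym.
- apply (le Q P v u l); auto; [intros; apply PQ; assumption | intros j h h'; symmetry; auto].
- apply (le P Q u v l); auto; intros; apply PQ; assumption.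
Qed.

(** * Hyperbolic identities and explicit solutions of the sixth-order equation *)

Lemma cosh2 (x : R) : cosh x ^ 2 = 1 + sinh x ^ 2.
Proof.
unfold cosh, sinh.
assert (E : exp x * exp (- x) = 1) by (rewrite <- exp_plus, Rplus_opp_r; apply exp_0).
nra.
Qed.

Lemma cosh_pos (x : R) : 0 < cosh x.
Proof. unfold cosh; pose proof (exp_pos x); pose proof (exp_pos (- x)); lra. Qed.

Lemma sinh_pos (x : R) : 0 < x -> 0 < sinh x.
Proof. intros Hx; rewrite <- sinh_0; apply sinh_lt, Hx. Qed.

Lemma sinh_opp (x : R) : sinh (- x) = - sinh x.
Proof. unfold sinh; rewrite Ropp_involutive; field. Qed.

Lemma cosh_opp (x : R) : cosh (- x) = cosh x.
Proof. unfold cosh; rewrite Ropp_involutive; field. Qed.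

Lemma sinh_double (x : R) : sinh (2 * x) = 2 * sinh x * cosh x.
Proof.
unfold sinh, cosh; replace (2 * x) with (x + x) by ring.
rewrite Ropp_plus_distr, !exp_plus; field.
Qed.

Lemma cosh_double (x : R) : cosh (2 * x) = 1 + 2 * sinh x ^ 2.
Proof.
unfold sinh, cosh; replace (2 * x) with (x + x) by ring.
rewrite Ropp_plus_distr, !exp_plus.
assert (E : exp x * exp (- x) = 1) by (rewrite <- exp_plus, Rplus_opp_r; apply exp_0).
nra.
Qed.

Lemma sqrt3_sqr : sqrt 3 ^ 2 = 3.
Proof. apply pow2_sqrt; lra. Qed.

Lemma sqrt3_pos : 0 < sqrt 3.
Proof. apply sqrt_lt_R0; lra. Qed.

(* Coordinates of a solution of [- f^(6) = f] in the basis [cos y], [sin y],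
   [cos (y/2) cosh (sqrt 3 y/2)], [sin sinh], [cos sinh], [sin cosh]. *)
Record coords := Coords { c1 : R; c2 : R; c3 : R; c4 : R; c5 : R; c6 : R }.

Definition wave (v : coords) (y : R) : R :=
  c1 v * cos y + c2 v * sin y
  + c3 v * (cos (y / 2) * cosh (sqrt 3 * y / 2))
  + c4 v * (sin (y / 2) * sinh (sqrt 3 * y / 2))
  + c5 v * (cos (y / 2) * sinh (sqrt 3 * y / 2))
  + c6 v * (sin (y / 2) * cosh (sqrt 3 * y / 2)).

(** Differentiation with respect to y, acting on coordinates. *)
Definition shift (v : coords) : coords :=
  Coords (c2 v) (- c1 v)
    ((sqrt 3 * c5 v + c6 v) / 2) ((sqrt 3 * c6 v - c5 v) / 2)
    ((sqrt 3 * c3 v + c4 v) / 2) ((sqrt 3 * c4 v - c3 v) / 2).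

Definition scale (e : R) (v : coords) : coords :=
  Coords (e * c1 v) (e * c2 v) (e * c3 v) (e * c4 v) (e * c5 v) (e * c6 v).

(** The substitution y |-> - y; the parity of a solution is expressed as [reflect v = scale e v]. *)
Definition reflect (v : coords) : coords :=
  Coords (c1 v) (- c2 v) (c3 v) (c4 v) (- c5 v) (- c6 v).

Definition wave_chain (l : R) (v : coords) (k : nat) (x : R) : R :=
  l ^ k * wave (Nat.iter k shift v) (l * x).

Lemma coords_eq (v v' : coords) :
  c1 v = c1 v' -> c2 v = c2 v' -> c3 v = c3 v' -> c4 v = c4 v' ->
  c5 v = c5 v' -> c6 v = c6 v' -> v = v'.
Proof. destruct v, v'; simpl; intros; subst; reflexivity. Qed.

Lemma is_derive_wave (v : coords) (y : R) : is_derive (wave v) y (wave (shift v) y).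
Proof.
unfold wave.
auto_derive; [exact I|].
unfold shift, Rdiv; simpl; ring.
Qed.

Lemma wave_scale (e : R) (v : coords) (y : R) : wave (scale e v) y = e * wave v y.
Proof. unfold wave; simpl; ring. Qed.

Lemma wave_opp (v : coords) (y : R) : wave v (- y) = wave (reflect v) y.
Proof.
unfold wave; simpl.
replace (sqrt 3 * - y / 2) with (- (sqrt 3 * y / 2)) by field.
replace (- y / 2) with (- (y / 2)) by field.
rewrite !cos_neg, !sin_neg, !sinh_opp, !cosh_opp; ring.
Qed.

Lemma iter_shift_scale (k : nat) (e : R) (v : coords) :
  Nat.iter k shift (scale e v) = scale e (Nat.iter k shift v).
Proof.
induction k as [|k IH]; [reflexivity|]; simpl; rewrite IH.
apply coords_eq; simpl; field.
Qed.

Lemma reflect_iter_shift (k : nat) (v : coords) :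
  reflect (Nat.iter k shift v) = scale ((-1) ^ k) (Nat.iter k shift (reflect v)).
Proof.
induction k as [|k IH]; [apply coords_eq; simpl; ring|].
change (reflect (shift (Nat.iter k shift v)) =
        scale ((-1) ^ S k) (shift (Nat.iter k shift (reflect v)))).
assert (E : reflect (shift (Nat.iter k shift v)) = scale (-1) (shift (reflect (Nat.iter k shift v))))
  by (apply coords_eq; simpl; field).
rewrite E, IH; apply coords_eq; simpl; field.
Qed.

(** The second derivative is -1 on the first pair of coordinates and a rotation through pi/3 on each
    of the other two pairs, so its cube is -1. *)
Lemma shift2 (v : coords) :
  shift (shift v) = Coords (- c1 v) (- c2 v)
    ((c3 v + sqrt 3 * c4 v) / 2) ((c4 v - sqrt 3 * c3 v) / 2)
    ((c5 v + sqrt 3 * c6 v) / 2) ((c6 v - sqrt 3 * c5 v) / 2).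
Proof. pose proof sqrt3_sqr as H; apply coords_eq; simpl; field [H]. Qed.

Lemma shift6 (v : coords) : Nat.iter 6 shift v = scale (-1) v.
Proof.
pose proof sqrt3_sqr as H; simpl; rewrite !shift2; apply coords_eq; simpl; field [H].
Qed.

Lemma wave_chain_derivative (l : R) (v : coords) : derivative_chain (wave_chain l v).
Proof.
intros k x; unfold wave_chain.
replace (l ^ S k * wave (Nat.iter (S k) shift v) (l * x))
  with (l ^ k * (l * wave (shift (Nat.iter k shift v)) (l * x))) by (simpl; ring).
apply (is_derive_scal (fun x => wave _ (l * x))).
apply (is_derive_comp (wave _) (fun x => l * x)); [apply is_derive_wave|].
auto_derive; [exact I | ring].
Qed.

Lemma wave_chain_6 (l : R) (v : coords) (j : nat) (x : R) :
  wave_chain l v (6 + j) x = - l ^ 6 * wave_chain l v j x.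
Proof.
unfold wave_chain; rewrite Nat.iter_add, shift6, wave_scale, pow_add; ring.
Qed.

Lemma wave_chain_parity (e l : R) (v : coords) (k : nat) (x : R) :
  reflect v = scale e v ->
  wave_chain l v k (- x) = (-1) ^ k * e * wave_chain l v k x.
Proof.
intros Hv; unfold wave_chain.
replace (l * - x) with (- (l * x)) by ring.
rewrite wave_opp, reflect_iter_shift, Hv, iter_shift_scale, !wave_scale; ring.
Qed.

(** * From the adjoint problem to the first problem *)

(** This is - phi'' / l^2: in the variable y = l x the factor l^2 is already divided out. The sign
    keeps the coefficients of cos and sin unchanged. *)
Definition psi_coords (v : coords) : coords := scale (-1) (Nat.iter 2 shift v).

Lemma psi_coords_parity (e : R) (v : coords) :
  reflect v = scale e v -> reflect (psi_coords v) = scale e (psi_coords v).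
Proof.
intros Hv; unfold psi_coords; rewrite <- iter_shift_scale, reflect_iter_shift.
replace (reflect (scale (-1) v)) with (scale (-1) (scale e v))
  by (rewrite <- Hv; apply coords_eq; simpl; ring).
rewrite !iter_shift_scale; apply coords_eq; simpl; field.
Qed.

(* If [f] solves the adjoint problem then [f''] solves the first one. *)
Section Eigenpair.
Variables (e l : R) (v : coords).
Hypothesis e2 : e ^ 2 = 1.
Hypothesis l_pos : 0 < l.
Hypothesis v_parity : reflect v = scale e v.
Hypothesis v1 : wave (Nat.iter 1 shift v) l = 0.
Hypothesis v2 : wave (Nat.iter 2 shift v) l = 0.
Hypothesis v3 : wave (Nat.iter 3 shift v) l = 0.
Hypothesis v4 : wave (Nat.iter 4 shift v) l <> 0.

Let v' := psi_coords v.

Let chain1 w k : wave_chain l w k 1 = l ^ k * wave (Nat.iter k shift w) l.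
Proof. unfold wave_chain; rewrite Rmult_1_r; reflexivity. Qed.

Let adjoint_conditions k : In k adjoint_bc -> wave_chain l v k (-1) = 0 /\ wave_chain l v k 1 = 0.
Proof.
intros Hk; replace (-1) with (- (1)) by ring.
rewrite (wave_chain_parity e) by exact v_parity.
assert (Z : wave_chain l v k 1 = 0).
{ rewrite chain1; destruct Hk as [<-|[<-|[<-|[]]]]; rewrite ?v1, ?v2, ?v3; ring. }
rewrite Z; split; ring.
Qed.

Let first_conditions k : In k first_bc -> wave_chain l v' k (-1) = 0 /\ wave_chain l v' k 1 = 0.
Proof.
intros Hk; replace (-1) with (- (1)) by ring.
rewrite (wave_chain_parity e) by (apply psi_coords_parity; exact v_parity).
assert (Z : wave_chain l v' k 1 = 0).
{ rewrite chain1; unfold v', psi_coords; rewrite iter_shift_scale, wave_scale, <- Nat.iter_add.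
  destruct Hk as [<-|[<-|[<-|[]]]].
  - simpl Nat.add; rewrite v2; ring.
  - simpl Nat.add; rewrite v3; ring.
  (* The fifth derivative of psi is a multiple of the seventh of phi, which the equation reduces to
     the first. *)
  - change (5 + 2)%nat with (6 + 1)%nat.
    rewrite Nat.iter_add, shift6, wave_scale, v1; ring. }
rewrite Z; split; ring.
Qed.

(** With X the value on the right, psi''(1) = - l^2 X and phi''''(1) = l^4 X. By parity both
    endpoints contribute - l^6 X^2 to [inner_boundary], and division by - 6 l^6 remains. *)
Lemma eigenpair_inner :
  inner (wave_chain l v' 0) (wave_chain l v 0) = wave (Nat.iter 4 shift v) l ^ 2 / 3.
Proof.
pose proof (inner_boundary l (wave_chain l v') (wave_chain l v)
  (wave_chain_derivative l v') (wave_chain_derivative l v)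
  (fun x => wave_chain_6 l v' 0 x) (fun x => wave_chain_6 l v 0 x)
  (fun x => wave_chain_6 l v' 1 x) first_conditions adjoint_conditions) as H.
replace (-1) with (- (1)) in H by ring.
rewrite (wave_chain_parity e _ v'), (wave_chain_parity e _ v) in H
  by (assumption || apply psi_coords_parity; assumption).
rewrite !chain1 in H; unfold v' at 2 3, psi_coords in H.
rewrite !iter_shift_scale, !wave_scale, <- !Nat.iter_add in H; simpl Nat.add in H.
assert (Hl : l ^ 6 <> 0) by (apply pow_nonzero; lra).
apply (Rmult_eq_reg_l (- 6 * l ^ 6)); [|lra].
rewrite H; clear - e2; set (X := wave _ _).
transitivity (- (1 + e ^ 2) * l ^ 6 * X ^ 2); [ring | rewrite e2; field].
Qed.

Let inner_pos : inner (wave_chain l v' 0) (wave_chain l v 0) <> 0.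
Proof.
rewrite eigenpair_inner; pose proof (pow2_gt_0 _ v4); lra.
Qed.

Lemma eigenpair_adjoint : is_eigenfunction adjoint_bc l (wave_chain l v 0).
Proof.
apply (derivative_chain_eigenfunction _ _ (wave_chain l v)).
- apply wave_chain_derivative.
- intros x; apply (wave_chain_6 l v 0).
- apply (inner_neq_0 _ _ inner_pos).
- exact adjoint_conditions.
Qed.

Lemma eigenpair_first : is_eigenfunction first_bc l (wave_chain l v' 0).
Proof.
apply (derivative_chain_eigenfunction _ _ (wave_chain l v')).
- apply wave_chain_derivative.
- intros x; apply (wave_chain_6 l v' 0).
- apply (inner_neq_0 _ _ inner_pos).
- exact first_conditions.
Qed.

End Eigenpair.

(** * Absence of eigenvalues off the characteristic roots *)

(** The constant concomitant is evaluated at 0: each product pairs derivatives of orders [k] and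
    [5 - k], of opposite parity, so one factor vanishes there. *)
Lemma concomitant_parity (bc : list nat) (e l : R) (f : R -> R) (g : nat -> R -> R) :
  is_eigenfunction bc l f -> (forall x, -1 <= x <= 1 -> f (- x) = e * f x) ->
  derivative_chain g -> (forall x, g 6%nat x = - l ^ 6 * g 0%nat x) ->
  (forall k, e * g k 0 = (-1) ^ k * g k 0) -> e ^ 2 = 1 ->
  concomitant (Derive_n f) g 1 = 0.
Proof.
intros Hf He Hg H6 Hp e2.
rewrite (eigenfunction_concomitant_constant bc l f g Hf (fun k x _ => Hg k x) H6 1 0) by lra.
assert (P : forall k, (k <= 5)%nat -> Derive_n f k 0 * g (5 - k)%nat 0 = 0).
{ intros k Hk.
  assert (D := Derive_n_0_parity e f k
     ltac:(intros; apply (proj1 Hf); lia) He).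
  specialize (Hp (5 - k)%nat).
  assert (E : e ^ 2 * (Derive_n f k 0 * g (5 - k)%nat 0) =
              (-1) ^ k * (-1) ^ (5 - k) * (Derive_n f k 0 * g (5 - k)%nat 0)).
  { transitivity ((e * Derive_n f k 0) * (e * g (5 - k)%nat 0)); [ring|].
    rewrite D, Hp; ring. }
  rewrite e2, <- pow_add in E; replace (k + (5 - k))%nat with 5%nat in E by lia.
  set (X := Derive_n f k 0 * g (5 - k)%nat 0) in *; clearbody X.
  simpl in E; lra. }
pose proof (P 0%nat ltac:(lia)); pose proof (P 1%nat ltac:(lia));
pose proof (P 2%nat ltac:(lia)); pose proof (P 3%nat ltac:(lia));
pose proof (P 4%nat ltac:(lia)); pose proof (P 5%nat ltac:(lia)).
unfold concomitant; cbn [Nat.sub] in *; lra.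
Qed.

Lemma concomitant_wave_chain (bc : list nat) (e l : R) (f : R -> R) (v : coords) :
  is_eigenfunction bc l f -> (forall x, -1 <= x <= 1 -> f (- x) = e * f x) ->
  e ^ 2 = 1 -> reflect v = scale e v ->
  concomitant (Derive_n f) (wave_chain l v) 1 = 0.
Proof.
intros Hf He e2 Hv.
apply (concomitant_parity bc e l); auto.
- apply wave_chain_derivative.
- intros x; apply (wave_chain_6 l v 0).
- intros k; pose proof (wave_chain_parity e l v k 0 Hv) as H; rewrite Ropp_0 in H.
  rewrite H at 1; transitivity ((-1) ^ k * e ^ 2 * wave_chain l v k 0); [ring|].
  rewrite e2; ring.
Qed.

Lemma eigenfunction_wave_Cauchy_data (bc : list nat) (l : R) (f : R -> R) :
  0 < l -> is_eigenfunction bc l f ->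
  ~ (forall k, (k <= 5)%nat -> Derive_n f k 1 = 0).
Proof.
intros Hl Hf.
(* This odd solution vanishes at 0 with its first four derivatives, and its fifth derivative in y is
   3. *)
set (v := Coords 0 1 0 0 (- sqrt 3) 1).
pose proof sqrt3_sqr as w2.
assert (V : forall w, wave w 0 = c1 w + c3 w).
{ intros w; unfold wave; replace (0 / 2) with 0 by field.
  replace (sqrt 3 * 0 / 2) with 0 by field.
  rewrite cos_0, sin_0, cosh_0, sinh_0; ring. }
apply (eigenfunction_Cauchy_data bc l f (wave_chain l v) Hf (wave_chain_derivative l v)
        (fun x => wave_chain_6 l v 0 x)).
- intros k Hk; unfold wave_chain; rewrite Rmult_0_r, V.
  do 5 (destruct k as [|k]; [simpl; field [w2] | ]); lia.
- unfold wave_chain; rewrite Rmult_0_r, V.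
  replace (_ + _) with 3 by (simpl; field [w2]).
  apply Rmult_integral_contrapositive; split; [apply pow_nonzero|]; lra.
Qed.

Section Nonexistence.
Variables (e l : R) (f : R -> R) (v m1 m2 : coords).
Hypothesis e2 : e ^ 2 = 1.
Hypothesis l_pos : 0 < l.
Hypothesis f_parity : forall x, -1 <= x <= 1 -> f (- x) = e * f x.
Hypothesis v_parity : reflect v = scale e v.
Hypothesis m1_parity : reflect m1 = scale e m1.
Hypothesis m2_parity : reflect m2 = scale e m2.
Hypothesis v1 : wave (Nat.iter 1 shift v) l = 0.
Hypothesis v2 : wave (Nat.iter 2 shift v) l <> 0.
Hypothesis v3 : wave (Nat.iter 3 shift v) l = 0.
Hypothesis m13 : wave (Nat.iter 3 shift m1) l =
  (wave (Nat.iter 1 shift m1) l - sqrt 3 * wave (Nat.iter 1 shift m2) l) / 2.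
Hypothesis m23 : wave (Nat.iter 3 shift m2) l =
  (wave (Nat.iter 1 shift m2) l + sqrt 3 * wave (Nat.iter 1 shift m1) l) / 2.
Hypothesis m12 : 0 < wave (Nat.iter 1 shift m1) l ^ 2 + wave (Nat.iter 1 shift m2) l ^ 2.

(** [m13] and [m23] say that the third derivatives are the first ones, U and V, rotated through
    pi/3. The determinant is therefore sqrt 3 / 2 times U^2 + V^2, positive by [m12]. *)
Let linear_system (A B : R) :
  A * wave (Nat.iter 1 shift m1) l = B * wave (Nat.iter 3 shift m1) l ->
  A * wave (Nat.iter 1 shift m2) l = B * wave (Nat.iter 3 shift m2) l ->
  A = 0 /\ B = 0.
Proof.
rewrite m13, m23; generalize m12.
generalize (wave (Nat.iter 1 shift m1) l) (wave (Nat.iter 1 shift m2) l).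
intros U V HUV E1 E2; pose proof sqrt3_pos.
assert (EB : B * (sqrt 3 * (U ^ 2 + V ^ 2)) = 0).
{ transitivity (2 * (U * (B * ((V + sqrt 3 * U) / 2))
                     - V * (B * ((U - sqrt 3 * V) / 2)))); [field|].
  rewrite <- E1, <- E2; ring. }
assert (B0 : B = 0).
{ apply Rmult_integral in EB; destruct EB as [EB|EB]; [exact EB|].
  assert (0 < sqrt 3 * (U ^ 2 + V ^ 2)) by (apply Rmult_lt_0_compat; assumption); lra. }
split; [|exact B0]; subst B.
destruct (Req_dec A 0) as [EA|EA]; [exact EA|].
assert (U = 0) by (apply (Rmult_eq_reg_l A); lra).
assert (V = 0) by (apply (Rmult_eq_reg_l A); lra).
exfalso; subst U V; nra.
Qed.

Let chain1 w k : wave_chain l w k 1 = l ^ k * wave (Nat.iter k shift w) l.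
Proof. unfold wave_chain; rewrite Rmult_1_r; reflexivity. Qed.

Let parity2 w : reflect w = scale e w ->
  reflect (Nat.iter 2 shift w) = scale e (Nat.iter 2 shift w).
Proof.
intros H; rewrite reflect_iter_shift, H, !iter_shift_scale.
apply coords_eq; simpl; field.
Qed.

Let lk k : l ^ k <> 0.
Proof. apply pow_nonzero; lra. Qed.

(** Testing against [v] leaves only the term f''' v'', so f'''(1) = 0. Testing against [m1] and [m2]
    then gives a regular system for f''(1) and f''''(1), and all Cauchy data at 1 vanish. *)
Lemma first_problem_nonexistence : ~ is_eigenfunction first_bc l f.
Proof.
intros Hf.
pose proof (proj2 (proj2 (proj2 Hf))) as Bf.
destruct (Bf 0%nat) as [_ f0]; [simpl; auto|].
destruct (Bf 1%nat) as [_ f1]; [simpl; auto|].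
destruct (Bf 5%nat) as [_ f5]; [simpl; auto|].
pose proof (fun w H => concomitant_wave_chain first_bc e l f w Hf f_parity e2 H) as W.
unfold concomitant in W.
pose proof (W v v_parity) as Wv; pose proof (W m1 m1_parity) as W1; pose proof (W m2 m2_parity) as W2.
rewrite !chain1, f0, f1, f5 in Wv, W1, W2.
rewrite v1, v3 in Wv.
assert (f3 : Derive_n f 3 1 = 0).
{ apply (Rmult_eq_reg_r (l ^ 2 * wave (Nat.iter 2 shift v) l)).
  - rewrite Rmult_0_l, <- Wv; ring.
  - apply Rmult_integral_contrapositive; auto. }
rewrite f3 in W1, W2.
destruct (linear_system (- Derive_n f 4 1 * l ^ 1) (Derive_n f 2 1 * l ^ 3)) as [f4 f2].
- apply Rminus_diag_uniq; rewrite <- W1; ring.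
- apply Rminus_diag_uniq; rewrite <- W2; ring.
- apply Rmult_integral in f4; destruct f4 as [f4|f4]; [|destruct (lk 1 f4)].
  apply Rmult_integral in f2; destruct f2 as [f2|f2]; [|destruct (lk 3 f2)].
  apply (eigenfunction_wave_Cauchy_data first_bc l f l_pos Hf); intros k Hk.
  do 6 (destruct k as [|k]; [assumption || lra |]); lia.
Qed.

(** The tests are now the second derivatives of [v], [m1], [m2]. As a seventh derivative is minus a
    first one up to powers of [l], the same system reappears, for f(1) and f''''(1), once [v] has
    given f^(5)(1) = 0. *)
Lemma adjoint_problem_nonexistence : ~ is_eigenfunction adjoint_bc l f.
Proof.
intros Hf.
pose proof (proj2 (proj2 (proj2 Hf))) as Bf.
destruct (Bf 1%nat) as [_ f1]; [simpl; auto|].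
destruct (Bf 2%nat) as [_ f2]; [simpl; auto|].
destruct (Bf 3%nat) as [_ f3]; [simpl; auto|].
pose proof (fun w H => concomitant_wave_chain adjoint_bc e l f w Hf f_parity e2 H) as W.
unfold concomitant in W.
pose proof (W _ (parity2 v v_parity)) as Wv; pose proof (W _ (parity2 m1 m1_parity)) as W1;
pose proof (W _ (parity2 m2 m2_parity)) as W2.
rewrite !chain1, f1, f2, f3, <- !Nat.iter_add in Wv, W1, W2.
change (5 + 2)%nat with (6 + 1)%nat in Wv, W1, W2.
rewrite (Nat.iter_add 6 1), !shift6, !wave_scale in Wv, W1, W2.
simpl Nat.add in Wv, W1, W2.
rewrite v1, v3 in Wv.
assert (f5 : Derive_n f 5 1 = 0).
{ apply (Rmult_eq_reg_r (wave (Nat.iter 2 shift v) l)); [|exact v2].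
  rewrite Rmult_0_l, <- Wv; ring. }
rewrite f5 in W1, W2.
destruct (linear_system (Derive_n f 0 1 * l ^ 5) (Derive_n f 4 1 * l ^ 1)) as [f0 f4].
- apply Rminus_diag_uniq; rewrite <- W1; ring.
- apply Rminus_diag_uniq; rewrite <- W2; ring.
- apply Rmult_integral in f0; destruct f0 as [f0|f0]; [|destruct (lk 5 f0)].
  apply Rmult_integral in f4; destruct f4 as [f4|f4]; [|destruct (lk 1 f4)].
  apply (eigenfunction_wave_Cauchy_data adjoint_bc l f l_pos Hf); intros k Hk.
  do 6 (destruct k as [|k]; [assumption || lra |]); lia.
Qed.

End Nonexistence.

(** * The eigenvalue zero *)

(** For [lam = 0] the polynomials of degree at most five solve the equation and replace the
    waves. *)
Definition poly_chain (a0 a1 a2 a3 a4 a5 : R) (k : nat) (x : R) : R :=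
  match k with
  | 0 => a0 + a1 * x + a2 * x ^ 2 + a3 * x ^ 3 + a4 * x ^ 4 + a5 * x ^ 5
  | 1 => a1 + 2 * a2 * x + 3 * a3 * x ^ 2 + 4 * a4 * x ^ 3 + 5 * a5 * x ^ 4
  | 2 => 2 * a2 + 6 * a3 * x + 12 * a4 * x ^ 2 + 20 * a5 * x ^ 3
  | 3 => 6 * a3 + 24 * a4 * x + 60 * a5 * x ^ 2
  | 4 => 24 * a4 + 120 * a5 * x
  | 5 => 120 * a5
  | _ => 0
  end.

Lemma poly_chain_derivative (a0 a1 a2 a3 a4 a5 : R) :
  derivative_chain (poly_chain a0 a1 a2 a3 a4 a5).
Proof.
intros k x; do 6 (destruct k as [|k]; [unfold poly_chain; auto_derive; [exact I | ring]|]).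
apply (is_derive_const (V := R_NormedModule)).
Qed.

Lemma poly_chain_6 (a0 a1 a2 a3 a4 a5 x : R) :
  poly_chain a0 a1 a2 a3 a4 a5 6 x = - 0 ^ 6 * poly_chain a0 a1 a2 a3 a4 a5 0 x.
Proof. simpl; ring. Qed.

Lemma zero_first_eigenfunction : is_eigenfunction first_bc 0 (psi_c 0 0).
Proof.
apply (is_eigenfunction_ext _ _ (poly_chain 1 0 (-2) 0 1 0 0)); [intros x; simpl; ring|].
apply derivative_chain_eigenfunction.
- apply poly_chain_derivative.
- intros; apply poly_chain_6.
- exists 0; split; [lra|]; simpl; lra.
- intros k [<-|[<-|[<-|[]]]]; simpl; lra.
Qed.

Lemma zero_adjoint_eigenfunction : is_eigenfunction adjoint_bc 0 (phi_c 0 0).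
Proof.
apply (is_eigenfunction_ext _ _ (poly_chain 1 0 0 0 0 0 0)); [intros x; simpl; ring|].
apply derivative_chain_eigenfunction.
- apply poly_chain_derivative.
- intros; apply poly_chain_6.
- exists 0; split; [lra|]; simpl; lra.
- intros k [<-|[<-|[<-|[]]]]; simpl; lra.
Qed.

(** The test functions x, x^3, x^5 give three relations which, with the three boundary conditions,
    annihilate all Cauchy data at 1. *)
Lemma zero_not_odd_eigenvalue (bc : list nat) :
  bc = first_bc \/ bc = adjoint_bc -> ~ odd_eigenvalue bc 0.
Proof.
intros Hbc [_ [f [Hf Ho]]].
assert (W : forall a1 a3 a5,
  concomitant (Derive_n f) (poly_chain 0 a1 0 a3 0 a5) 1 = 0).
{ intros; apply (concomitant_parity bc (-1) 0); auto.
  - intros x Hx; rewrite Ho by assumption; ring.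
  - apply poly_chain_derivative.
  - intros; apply poly_chain_6.
  - intros k; do 6 (destruct k as [|k]; [simpl; ring|]); simpl; ring.
  - ring. }
assert (W1 := W 1 0 0); assert (W3 := W 0 1 0); assert (W5 := W 0 0 1).
apply (eigenfunction_Cauchy_data bc 0 f (poly_chain 0 0 0 0 0 1) Hf).
- apply poly_chain_derivative.
- intros; apply poly_chain_6.
- intros k Hk; do 5 (destruct k as [|k]; [simpl; ring|]); lia.
- simpl; lra.
- pose proof (proj2 (proj2 (proj2 Hf))) as Bf.
  unfold concomitant in W1, W3, W5; cbn [poly_chain] in W1, W3, W5.
  destruct Hbc; subst bc.
  + destruct (Bf 0%nat) as [_ f0]; [simpl; auto|].
    destruct (Bf 1%nat) as [_ f1]; [simpl; auto|].
    destruct (Bf 5%nat) as [_ f5]; [simpl; auto|].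
    rewrite f0, f1, f5 in W1, W3, W5.
    intros k Hk; do 6 (destruct k as [|k]; [lra |]); lia.
  + destruct (Bf 1%nat) as [_ f1]; [simpl; auto|].
    destruct (Bf 2%nat) as [_ f2]; [simpl; auto|].
    destruct (Bf 3%nat) as [_ f3]; [simpl; auto|].
    rewrite f1, f2, f3 in W1, W3, W5.
    intros k Hk; do 6 (destruct k as [|k]; [lra |]); lia.
Qed.

(** * Explicit solutions and the characteristic equations *)

(** In half-angle form every boundary value is a polynomial in four quantities s, c, S, C and sqrt
    3, so identities reduce to algebra modulo c^2 = 1 - s^2, C^2 = 1 + S^2 and sqrt 3 ^ 2 = 3. *)
Lemma wave_half (v : coords) (l : R) :
  wave v l =
  c1 v * (cos (l / 2) ^ 2 - sin (l / 2) ^ 2) + c2 v * (2 * sin (l / 2) * cos (l / 2))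
  + c3 v * (cos (l / 2) * cosh (sqrt 3 * l / 2))
  + c4 v * (sin (l / 2) * sinh (sqrt 3 * l / 2))
  + c5 v * (cos (l / 2) * sinh (sqrt 3 * l / 2))
  + c6 v * (sin (l / 2) * cosh (sqrt 3 * l / 2)).
Proof.
unfold wave.
rewrite <- (sin_2a (l / 2)).
replace (cos (l / 2) ^ 2 - sin (l / 2) ^ 2) with (cos (2 * (l / 2)))
  by (rewrite cos_2a; ring).
replace (2 * (l / 2)) with l by field; ring.
Qed.

Lemma cos2 (x : R) : cos x ^ 2 = 1 - sin x ^ 2.
Proof. pose proof (sin2_cos2 x) as H; unfold Rsqr in H; lra. Qed.

Lemma sinh_half_pos (l : R) : 0 < l -> 0 < sinh (sqrt 3 * l / 2).
Proof.
intros Hl; apply sinh_pos.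
pose proof (Rmult_lt_0_compat _ _ sqrt3_pos Hl); lra.
Qed.

(* The coordinates of [phi_c] and [phi_s], simplified. For every [l > 0] these
   functions have vanishing first and third derivatives at 1; the vanishing of
   the second one is the characteristic equation. *)
Definition even_phi (l : R) : coords :=
  let s := sin (l / 2) in let c := cos (l / 2) in
  let S := sinh (sqrt 3 * l / 2) in let C := cosh (sqrt 3 * l / 2) in
  Coords 1 0 (2 * s * c * (sqrt 3 * c * S + s * C) / (s ^ 2 + S ^ 2))
             (2 * s * c * (sqrt 3 * s * C - c * S) / (s ^ 2 + S ^ 2)) 0 0.

Definition odd_phi (l : R) : coords :=
  let s := sin (l / 2) in let c := cos (l / 2) in
  let S := sinh (sqrt 3 * l / 2) in let C := cosh (sqrt 3 * l / 2) in
  let p := c ^ 2 - s ^ 2 in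
  Coords 0 1 0 0 (- p * (s * S + sqrt 3 * c * C) / (c ^ 2 + S ^ 2))
                 (p * (c * C - sqrt 3 * s * S) / (c ^ 2 + S ^ 2)).

Definition even_characteristic (l : R) : R :=
  cos (2 * l) + 2 * cos l * cosh (sqrt 3 * l) - 3.

Ltac wave_values :=
  rewrite ?wave_half; simpl Nat.iter; rewrite ?shift2;
  unfold even_phi, odd_phi; cbn [c1 c2 c3 c4 c5 c6 shift scale];
  cbv zeta.

Ltac half_variables l :=
  pose proof sqrt3_sqr as w2; pose proof sqrt3_pos as w_pos;
  pose proof (cosh2 (sqrt 3 * l / 2)) as C2; pose proof (cos2 (l / 2)) as c2';
  pose proof (cosh_pos (sqrt 3 * l / 2)) as C_pos;
  set (S := sinh (sqrt 3 * l / 2)) in *; set (C := cosh (sqrt 3 * l / 2)) in *;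
  set (s := sin (l / 2)) in *; set (c := cos (l / 2)) in *; set (w := sqrt 3) in *;
  clearbody S C s c w.

Lemma even_phi_parity (l : R) : reflect (even_phi l) = scale 1 (even_phi l).
Proof. apply coords_eq; simpl; ring. Qed.

Lemma odd_phi_parity (l : R) : reflect (odd_phi l) = scale (-1) (odd_phi l).
Proof. apply coords_eq; simpl; ring. Qed.

Lemma even_phi_1 (l : R) : 0 < l -> wave (Nat.iter 1 shift (even_phi l)) l = 0.
Proof.
intros Hl; pose proof (sinh_half_pos l Hl) as S_pos.
wave_values; half_variables l.
field [w2 C2 c2']; nra.
Qed.

(** Multiplied by - 4 (s^2 + S^2), this is [even_characteristic l]. *)
Lemma even_phi_2 (l : R) : 0 < l ->
  let s := sin (l / 2) in let c := cos (l / 2) in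
  let S := sinh (sqrt 3 * l / 2) in
  wave (Nat.iter 2 shift (even_phi l)) l =
  4 * s ^ 2 * c ^ 2 / (s ^ 2 + S ^ 2) - (c ^ 2 - s ^ 2).
Proof.
intros Hl; pose proof (sinh_half_pos l Hl) as S_pos; intros s0 c0 S0; unfold s0, c0, S0.
wave_values; half_variables l.
field [w2 C2 c2']; nra.
Qed.

Lemma even_phi_3 (l : R) : 0 < l -> wave (Nat.iter 3 shift (even_phi l)) l = 0.
Proof.
intros Hl; pose proof (sinh_half_pos l Hl) as S_pos.
wave_values; half_variables l.
field [w2 C2 c2']; nra.
Qed.

Lemma odd_phi_1 (l : R) : 0 < l -> wave (Nat.iter 1 shift (odd_phi l)) l = 0.
Proof.
intros Hl; pose proof (sinh_half_pos l Hl) as S_pos.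
wave_values; half_variables l.
field [w2 C2 c2']; nra.
Qed.

(** The value is - sin l times a positive factor, so it vanishes exactly when sin l does. *)
Lemma odd_phi_2 (l : R) : 0 < l ->
  let s := sin (l / 2) in let c := cos (l / 2) in
  let S := sinh (sqrt 3 * l / 2) in
  wave (Nat.iter 2 shift (odd_phi l)) l =
  - 2 * s * c * (s ^ 2 + S ^ 2) / (c ^ 2 + S ^ 2).
Proof.
intros Hl; pose proof (sinh_half_pos l Hl) as S_pos; intros s0 c0 S0; unfold s0, c0, S0.
wave_values; half_variables l.
field [w2 C2 c2']; nra.
Qed.

Lemma odd_phi_3 (l : R) : 0 < l -> wave (Nat.iter 3 shift (odd_phi l)) l = 0.
Proof.
intros Hl; pose proof (sinh_half_pos l Hl) as S_pos.
wave_values; half_variables l.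
field [w2 C2 c2']; nra.
Qed.

(** * Closed forms and normalising constants modulo the characteristic equations *)

Lemma cos_half (l : R) : cos l = cos (l / 2) ^ 2 - sin (l / 2) ^ 2.
Proof. replace l with (2 * (l / 2)) at 1 by field; rewrite cos_2a; ring. Qed.

Lemma sin_half (l : R) : sin l = 2 * sin (l / 2) * cos (l / 2).
Proof. replace l with (2 * (l / 2)) at 1 by field; apply sin_2a. Qed.

Lemma cosh_half (l : R) : cosh (sqrt 3 * l) = 1 + 2 * sinh (sqrt 3 * l / 2) ^ 2.
Proof. rewrite <- cosh_double; f_equal; field. Qed.

Lemma sinh_half (l : R) :
  sinh (sqrt 3 * l) = 2 * sinh (sqrt 3 * l / 2) * cosh (sqrt 3 * l / 2).
Proof. rewrite <- sinh_double; f_equal; field. Qed.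

Lemma even_characteristic_half (l : R) :
  even_characteristic l =
  4 * ((cos (l / 2) ^ 2 - sin (l / 2) ^ 2) * (sin (l / 2) ^ 2 + sinh (sqrt 3 * l / 2) ^ 2)
       - 4 * sin (l / 2) ^ 2 * cos (l / 2) ^ 2).
Proof.
unfold even_characteristic; rewrite cos_2a, (cosh_half l), (cos_half l), (sin_half l).
pose proof (cos2 (l / 2)) as H; ring [H].
Qed.

(** Keeps the denominators of the closed forms away from zero. If s c = 0, the characteristic
    equation forces cos l = 0 as well as sin l = 0, which is absurd; equality in the last claim
    would again give s c = 0. *)
Lemma even_characteristic_nonzero (l : R) :
  0 < l -> even_characteristic l = 0 ->
  sin (l / 2) <> 0 /\ cos (l / 2) <> 0 /\ sqrt 3 * sin l <> sinh (sqrt 3 * l).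
Proof.
intros Hl; rewrite even_characteristic_half, (sin_half l), (sinh_half l).
pose proof (sinh_half_pos l Hl) as S_pos.
half_variables l; intros E.
assert (E' : (c ^ 2 - s ^ 2) * (s ^ 2 + S ^ 2) = 4 * s ^ 2 * c ^ 2) by lra; clear E.
assert (N : 0 < s ^ 2 + S ^ 2) by nra.
assert (K : s * c <> 0).
{ intros K; assert (P : c ^ 2 - s ^ 2 = 0).
  { apply (Rmult_eq_reg_r (s ^ 2 + S ^ 2)); [|lra].
    rewrite E', Rmult_0_l; transitivity (4 * (s * c) ^ 2); [ring | rewrite K; ring]. }
  assert (Q : 4 * (s * c) ^ 2 = 1) by (transitivity (1 - (c ^ 2 - s ^ 2) ^ 2);
    [ring [c2'] | rewrite P; ring]).
  rewrite K in Q; lra. }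
split; [intros Z; apply K; rewrite Z; ring|].
split; [intros Z; apply K; rewrite Z; ring|].
intros H.
(* With [p = cos l], the characteristic equation turns [3 sin^2 l = sinh^2 (sqrt 3 l)]
   into [4 (p^2 - 1)^2 = 0]. *)
assert (H2 : 3 * (s * c) ^ 2 = S ^ 2 * C ^ 2).
{ transitivity ((w * (s * c)) ^ 2); [rewrite <- w2; ring|].
  replace (w * (s * c)) with (S * C) by lra; ring. }
apply K.
assert (D : 64 * (s * c) ^ 4 = 0).
{ set (p := c ^ 2 - s ^ 2) in *.
  assert (Ep : 2 - p ^ 2 = p * (1 + 2 * S ^ 2)) by (unfold p in *; rewrite c2' in *; lra).
  assert (Eq : 3 * (1 - p ^ 2) = (1 + 2 * S ^ 2) ^ 2 - 1).
  { transitivity (4 * (3 * (s * c) ^ 2)); [unfold p; ring [c2'] | rewrite H2; ring [C2]]. }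
  transitivity ((2 - p ^ 2) ^ 2 - p ^ 2 - p ^ 2 * (3 * (1 - p ^ 2))); [unfold p; ring [c2']|].
  rewrite Ep, Eq; ring. }
destruct (Req_dec (s * c) 0) as [Z|Z]; [exact Z|].
pose proof (pow_nonzero _ 4 Z); lra.
Qed.

(** The last factor is sqrt 3 / 2 times sqrt 3 sin l - sinh (sqrt 3 l), so the value is nonzero by
    [even_characteristic_nonzero]. *)
Lemma even_phi_4 (l : R) : 0 < l -> even_characteristic l = 0 ->
  wave (Nat.iter 4 shift (even_phi l)) l =
  2 * sin (l / 2) * cos (l / 2) / (sin (l / 2) ^ 2 + sinh (sqrt 3 * l / 2) ^ 2)
  * (3 * sin (l / 2) * cos (l / 2) - sqrt 3 * sinh (sqrt 3 * l / 2) * cosh (sqrt 3 * l / 2)).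
Proof.
intros Hl; pose proof (sinh_half_pos l Hl) as S_pos.
rewrite even_characteristic_half.
wave_values; half_variables l; intros E.
(* The characteristic equation solved for s^4, to serve as a rewriting rule. *)
assert (s4 : s ^ 4 = (3 * s ^ 2 - S ^ 2 + 2 * s ^ 2 * S ^ 2) / 2)
  by (rewrite c2' in E; lra).
field_simplify_eq [w2 C2 c2' s4]; [field | nra].
Qed.

(** The given formula agrees with - phi'' / l^2 modulo the characteristic equation. The index is a
    successor because [psi_c] only distinguishes 0 from the rest. *)
Lemma psi_c_wave (m : nat) (l x : R) : 0 < l -> even_characteristic l = 0 ->
  wave_chain l (psi_coords (even_phi l)) 0 x = psi_c (S m) l x.
Proof.
intros Hl Hc; pose proof (sinh_half_pos l Hl) as S_pos.
destruct (even_characteristic_nonzero l Hl Hc) as [s0 [c0 K0]].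
revert Hc K0; rewrite even_characteristic_half.
unfold wave_chain, psi_coords, psi_c, wave; simpl Nat.iter; rewrite shift2.
unfold even_phi; cbn [c1 c2 c3 c4 c5 c6 scale]; cbv zeta.
replace (sqrt 3 * (l * x) / 2) with (sqrt 3 * l * x / 2) by field.
unfold tan, tanh.
rewrite (sin_half l), (cos_half l), (sinh_half l).
half_variables l; intros E K.
assert (s4 : s ^ 4 = (3 * s ^ 2 - S ^ 2 + 2 * s ^ 2 * S ^ 2) / 2)
  by (rewrite c2' in E; lra).
assert (N : s ^ 2 + S ^ 2 <> 0) by nra.
assert (K' : w * s * c - S * C <> 0) by lra.
field_simplify_eq [w2 C2 c2' s4]; [field | repeat split; lra].
Qed.

Lemma phi_c_wave (m : nat) (l x : R) : 0 < l -> even_characteristic l = 0 ->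
  wave_chain l (even_phi l) 0 x = phi_c (S m) l x.
Proof.
intros Hl Hc; pose proof (sinh_half_pos l Hl) as S_pos.
destruct (even_characteristic_nonzero l Hl Hc) as [s0 [c0 K0]].
unfold wave_chain, phi_c, wave; simpl Nat.iter.
unfold even_phi; cbn [c1 c2 c3 c4 c5 c6]; cbv zeta.
replace (sqrt 3 * (l * x) / 2) with (sqrt 3 * l * x / 2) by field.
unfold csc, sech, cot, tanh.
rewrite (sin_half l), (cos_half l), (cosh_half l).
half_variables l.
field [w2 C2 c2'].
repeat split; nra.
Qed.

Lemma sin_3a (x : R) : sin (3 * x) = 3 * sin x - 4 * sin x ^ 3.
Proof.
replace (3 * x) with (2 * x + x) by ring; rewrite sin_plus, sin_2a, cos_2a.
pose proof (cos2 x) as H; ring [H].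
Qed.

Lemma cos_3a (x : R) : cos (3 * x) = 4 * cos x ^ 3 - 3 * cos x.
Proof.
replace (3 * x) with (2 * x + x) by ring; rewrite cos_plus, sin_2a, cos_2a.
pose proof (cos2 x) as H; ring [H].
Qed.

Lemma cos_4a (x : R) : cos (4 * x) = 2 * (2 * cos x ^ 2 - 1) ^ 2 - 1.
Proof.
replace (4 * x) with (2 * (2 * x)) by ring; rewrite cos_2a_cos, cos_2a_cos; ring.
Qed.

(** Modulo the characteristic equation the bracket collapses to a cube, one factor of which cancels
    in the denominator of [c_const]. *)
Lemma c_const_bracket (l : R) : even_characteristic l = 0 ->
  4 * sqrt 3 * (cos l) ^ 2 * cosh (2 * sqrt 3 * l)
       - 2 * sqrt 3 * cosh (sqrt 3 * l)
         * (- 18 * l * sin l + 7 * cos l + cos (3 * l))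
       - 2 * sqrt 3 * (9 * l * sin (2 * l) - 7 * cos (2 * l) + cos (4 * l))
       + 6 * sinh (sqrt 3 * l) * (7 * sin l - sin (3 * l) + 2 * l * cos (3 * l))
       - 6 * (l + sin (2 * l)) * sinh (2 * sqrt 3 * l)
  = 6 * l * cos l * (sqrt 3 * sin l - sinh (sqrt 3 * l)) ^ 3.
Proof.
unfold even_characteristic.
replace (2 * sqrt 3 * l) with (2 * (sqrt 3 * l)) by ring.
rewrite sin_3a, cos_3a, cos_4a, cos_2a_cos, sin_2a, sinh_double, cosh_double.
pose proof (cosh2 (sqrt 3 * l)) as H1; pose proof (cos2 l) as H2; pose proof sqrt3_sqr as w2.
set (S := sinh (sqrt 3 * l)) in *; set (C := cosh (sqrt 3 * l)) in *; set (w := sqrt 3) in *.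
set (p := cos l) in *; set (q := sin l) in *; clearbody S C w p q.
intros E.
(* The characteristic equation with cos (2 l) expanded; [q2] combines it with sin^2 + cos^2 = 1. *)
assert (p2 : p ^ 2 = 2 - p * C) by lra.
assert (q2 : q ^ 2 = p * C - 1) by lra.
assert (S2 : S ^ 2 = C ^ 2 - 1) by lra.
ring [p2 q2 S2 w2].
Qed.

Lemma c_const_value (m : nat) (l : R) : 0 < l -> even_characteristic l = 0 ->
  wave (Nat.iter 4 shift (even_phi l)) l ^ 2 / 3 = c_const (S m) l.
Proof.
intros Hl Hc; pose proof (sinh_half_pos l Hl) as S_pos.
destruct (even_characteristic_nonzero l Hl Hc) as [s0 [c0 K0]].
unfold c_const; rewrite c_const_bracket, even_phi_4 by assumption.
revert Hc K0; rewrite even_characteristic_half.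
unfold csc, sech, cot, tanh; rewrite (sin_half l), (cos_half l), (sinh_half l).
half_variables l; intros E K.
assert (N : s ^ 2 + S ^ 2 <> 0) by nra.
(* The characteristic equation solved for cos l, which replaces the factor cos l left by
   [c_const_bracket]. *)
assert (p : c ^ 2 - s ^ 2 = 4 * s ^ 2 * c ^ 2 / (s ^ 2 + S ^ 2))
  by (apply (Rmult_eq_reg_r (s ^ 2 + S ^ 2)); [|exact N];
      transitivity (4 * s ^ 2 * c ^ 2); [lra | field; exact N]).
rewrite p.
field [w2 C2 c2'].
repeat split; nra.
Qed.

Lemma sin_zero_half (l : R) : sin l = 0 -> sin (l / 2) = 0 \/ cos (l / 2) = 0.
Proof.
rewrite sin_half; intros H.
apply Rmult_integral in H; destruct H as [H|H]; [left; lra | right; exact H].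
Qed.

(** Since sin l = 0, either s = 0 and c^2 = 1, or c = 0 and s^2 = 1. The boundary value is sqrt 3
    tanh (sqrt 3 l / 2) in the first case and - sqrt 3 coth (sqrt 3 l / 2) in the second. *)
Lemma odd_phi_4 (l : R) : 0 < l -> sin l = 0 ->
  wave (Nat.iter 4 shift (odd_phi l)) l ^ 2 / 3 = s_const l /\
  wave (Nat.iter 4 shift (odd_phi l)) l <> 0.
Proof.
intros Hl Hs; pose proof (sinh_half_pos l Hl) as S_pos.
unfold s_const, csch, sech.
replace (2 * sqrt 3 * l) with (2 * (sqrt 3 * l)) by ring.
rewrite cosh_double, sinh_double, cos_4a, cos_2a_cos, sin_2a, Hs.
rewrite (cos_half l), (cosh_half l), (sinh_half l).
wave_values.
generalize (sin_zero_half l Hs).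
half_variables l; intros [Z|Z]; rewrite Z in *.
- assert (c2 : c ^ 2 = 1) by lra.
  split; [field [c2 C2 w2]; repeat split; nra|].
  replace (_ + _) with (w * S / C) by (field [c2 C2 w2]; split; nra).
  apply Rgt_not_eq, Rdiv_lt_0_compat; [apply Rmult_lt_0_compat|]; assumption.
- assert (s2 : s ^ 2 = 1) by lra.
  split; [field [s2 C2 w2]; repeat split; nra|].
  replace (_ + _) with (- (w * C / S)) by (field [s2 C2 w2]; lra).
  apply Ropp_neq_0_compat, Rgt_not_eq, Rdiv_lt_0_compat; [apply Rmult_lt_0_compat|]; assumption.
Qed.

Lemma psi_s_wave (l x : R) : 0 < l -> sin l = 0 ->
  wave_chain l (psi_coords (odd_phi l)) 0 x = psi_s l x.
Proof.
intros Hl Hs; pose proof (sinh_half_pos l Hl) as S_pos.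
unfold wave_chain, psi_coords, psi_s, wave; simpl Nat.iter; rewrite shift2.
unfold odd_phi; cbn [c1 c2 c3 c4 c5 c6 scale]; cbv zeta.
replace (sqrt 3 * (l * x) / 2) with (sqrt 3 * l * x / 2) by field.
rewrite (sinh_half l); generalize (sin_zero_half l Hs).
half_variables l; intros [Z|Z]; rewrite Z in *.
- assert (c2 : c ^ 2 = 1) by lra.
  field [c2 C2 w2]; repeat split; try nra.
- assert (s2 : s ^ 2 = 1) by lra.
  field [s2 C2 w2]; repeat split; try nra.
Qed.

Lemma phi_s_wave (l x : R) : 0 < l -> wave_chain l (odd_phi l) 0 x = phi_s l x.
Proof.
intros Hl; pose proof (sinh_half_pos l Hl) as S_pos.
unfold wave_chain, phi_s, wave; simpl Nat.iter.
unfold odd_phi; cbn [c1 c2 c3 c4 c5 c6]; cbv zeta.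
replace (sqrt 3 * (l * x) / 2) with (sqrt 3 * l * x / 2) by field.
unfold csch, coth.
rewrite (cos_half l), (cosh_half l).
half_variables l.
field [w2 C2 c2'].
repeat split; try nra.
Qed.

(** * Eigenpairs, spectra and the biorthogonality relations *)

Lemma inner_ext (f f' g g' : R -> R) :
  (forall x, f x = f' x) -> (forall x, g x = g' x) -> inner f g = inner f' g'.
Proof. intros E E'; apply RInt_ext; intros x _; rewrite E, E'; reflexivity. Qed.

Lemma even_eigenpair (m : nat) (l : R) : 0 < l -> even_characteristic l = 0 ->
  (is_eigenfunction first_bc l (psi_c (S m) l) /\ even_function (psi_c (S m) l)) /\
  (is_eigenfunction adjoint_bc l (phi_c (S m) l) /\ even_function (phi_c (S m) l)) /\
  inner (psi_c (S m) l) (phi_c (S m) l) = c_const (S m) l /\ c_const (S m) l <> 0.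
Proof.
intros Hl Hc.
pose proof (even_characteristic_nonzero l Hl Hc) as [s0 [c0 K0]].
pose proof (sinh_half_pos l Hl) as S_pos.
pose proof (fun x => psi_c_wave m l x Hl Hc) as Epsi.
pose proof (fun x => phi_c_wave m l x Hl Hc) as Ephi.
assert (e2 : 1 ^ 2 = 1) by ring.
assert (v2 : wave (Nat.iter 2 shift (even_phi l)) l = 0).
{ rewrite even_phi_2 by exact Hl; rewrite even_characteristic_half in Hc.
  assert (0 < sin (l / 2) ^ 2 + sinh (sqrt 3 * l / 2) ^ 2) by nra.
  apply Rminus_diag_eq, (Rmult_eq_reg_r (sin (l / 2) ^ 2 + sinh (sqrt 3 * l / 2) ^ 2)); [|lra].
  transitivity (4 * sin (l / 2) ^ 2 * cos (l / 2) ^ 2); [field; lra | lra]. }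
assert (v4 : wave (Nat.iter 4 shift (even_phi l)) l <> 0).
{ rewrite even_phi_4 by assumption.
  assert (0 < sin (l / 2) ^ 2 + sinh (sqrt 3 * l / 2) ^ 2) by nra.
  rewrite sin_half, sinh_half in K0; half_variables l.
  apply Rmult_integral_contrapositive; split.
  - unfold Rdiv; repeat (apply Rmult_integral_contrapositive; split); try assumption; try lra.
    apply Rinv_neq_0_compat; lra.
  - intros Z; apply K0.
    apply (Rmult_eq_reg_l w); [|lra].
    transitivity (w ^ 2 * (2 * s * c)); [ring | rewrite w2; lra]. }
pose proof (even_phi_parity l) as Hv.
pose proof (eigenpair_inner 1 l (even_phi l) e2 Hl Hv (even_phi_1 l Hl) v2 (even_phi_3 l Hl)) as I.
pose proof (eigenpair_first 1 l (even_phi l) e2 Hl Hv (even_phi_1 l Hl) v2 (even_phi_3 l Hl) v4) as P.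
pose proof (eigenpair_adjoint 1 l (even_phi l) e2 Hl Hv (even_phi_1 l Hl) v2 (even_phi_3 l Hl) v4) as Q.
rewrite (inner_ext _ _ _ _ Epsi Ephi), (c_const_value m) in I by assumption.
split; [split|split; [split|split]].
- exact (is_eigenfunction_ext _ _ _ _ Epsi P).
- intros x _; rewrite <- !Epsi, (wave_chain_parity 1); [ring | apply psi_coords_parity, Hv].
- exact (is_eigenfunction_ext _ _ _ _ Ephi Q).
- intros x _; rewrite <- !Ephi, (wave_chain_parity 1); [ring | exact Hv].
- exact I.
- rewrite <- (c_const_value m) by assumption; pose proof (pow2_gt_0 _ v4); lra.
Qed.

Lemma odd_eigenpair (l : R) : 0 < l -> sin l = 0 ->
  (is_eigenfunction first_bc l (psi_s l) /\ odd_function (psi_s l)) /\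
  (is_eigenfunction adjoint_bc l (phi_s l) /\ odd_function (phi_s l)) /\
  inner (psi_s l) (phi_s l) = s_const l /\ s_const l <> 0.
Proof.
intros Hl Hs.
pose proof (fun x => psi_s_wave l x Hl Hs) as Epsi.
pose proof (fun x => phi_s_wave l x Hl) as Ephi.
pose proof (odd_phi_4 l Hl Hs) as [Ec v4].
assert (e2 : (-1) ^ 2 = 1) by ring.
assert (v2 : wave (Nat.iter 2 shift (odd_phi l)) l = 0).
{ rewrite odd_phi_2 by exact Hl; destruct (sin_zero_half l Hs) as [Z|Z]; rewrite Z;
    unfold Rdiv; ring. }
pose proof (odd_phi_parity l) as Hv.
pose proof (eigenpair_inner (-1) l (odd_phi l) e2 Hl Hv (odd_phi_1 l Hl) v2 (odd_phi_3 l Hl)) as I.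
pose proof (eigenpair_first (-1) l (odd_phi l) e2 Hl Hv (odd_phi_1 l Hl) v2 (odd_phi_3 l Hl) v4) as P.
pose proof (eigenpair_adjoint (-1) l (odd_phi l) e2 Hl Hv (odd_phi_1 l Hl) v2 (odd_phi_3 l Hl) v4) as Q.
rewrite (inner_ext _ _ _ _ Epsi Ephi), Ec in I.
split; [split|split; [split|split]].
- exact (is_eigenfunction_ext _ _ _ _ Epsi P).
- intros x _; rewrite <- !Epsi, (wave_chain_parity (-1)); [ring | apply psi_coords_parity, Hv].
- exact (is_eigenfunction_ext _ _ _ _ Ephi Q).
- intros x _; rewrite <- !Ephi, (wave_chain_parity (-1)); [ring | exact Hv].
- exact I.
- rewrite <- Ec; pose proof (pow2_gt_0 _ v4); lra.
Qed.

(** At a positive non-root, [even_phi l] has vanishing first and third but nonvanishing second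
    derivative at 1, as the nonexistence lemmas require. Conversely the explicit pairs are
    eigenfunctions. *)
Lemma even_eigenvalue_iff (bc : list nat) (l : R) : bc = first_bc \/ bc = adjoint_bc ->
  even_eigenvalue bc l <-> l = 0 \/ (0 < l /\ even_characteristic l = 0).
Proof.
intros Hbc; split.
- intros [[Hl|Hl] [f [Hf He]]]; [right; split; [exact Hl|] | left; auto].
  apply NNPP; intros Hc.
  assert (He' : forall x, -1 <= x <= 1 -> f (- x) = 1 * f x)
    by (intros x Hx; rewrite He by exact Hx; ring).
  pose proof (sinh_half_pos l Hl) as S_pos.
  (* The even solutions cos cosh and sin sinh; the squares of their first derivatives sum to s^2 +
     S^2. *)
  set (m1 := Coords 0 0 1 0 0 0); set (m2 := Coords 0 0 0 1 0 0).
  assert (v2 : wave (Nat.iter 2 shift (even_phi l)) l <> 0).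
  { rewrite even_phi_2 by exact Hl; rewrite even_characteristic_half in Hc; intros Z; apply Hc.
    assert (0 < sin (l / 2) ^ 2 + sinh (sqrt 3 * l / 2) ^ 2) by nra.
    apply Rminus_diag_uniq in Z; rewrite <- Z; field; lra. }
  assert (m13 : wave (Nat.iter 3 shift m1) l =
    (wave (Nat.iter 1 shift m1) l - sqrt 3 * wave (Nat.iter 1 shift m2) l) / 2)
    by (unfold wave; simpl; field [sqrt3_sqr]).
  assert (m23 : wave (Nat.iter 3 shift m2) l =
    (wave (Nat.iter 1 shift m2) l + sqrt 3 * wave (Nat.iter 1 shift m1) l) / 2)
    by (unfold wave; simpl; field [sqrt3_sqr]).
  assert (m12 : 0 < wave (Nat.iter 1 shift m1) l ^ 2 + wave (Nat.iter 1 shift m2) l ^ 2).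
  { rewrite !wave_half; simpl Nat.iter; cbn [c1 c2 c3 c4 c5 c6 shift m1 m2].
    half_variables l.
    replace (_ + _) with (s ^ 2 + S ^ 2); [nra | field [w2 C2 c2']]. }
  assert (P1 : reflect m1 = scale 1 m1) by (apply coords_eq; simpl; ring).
  assert (P2 : reflect m2 = scale 1 m2) by (apply coords_eq; simpl; ring).
  destruct Hbc; subst bc; revert Hf;
    [apply (first_problem_nonexistence 1 l f (even_phi l) m1 m2)
    |apply (adjoint_problem_nonexistence 1 l f (even_phi l) m1 m2)];
    auto using even_phi_parity, even_phi_1, even_phi_3; ring.
- intros [->|[Hl Hc]].
  + split; [lra|]; destruct Hbc; subst bc; eexists; split.
    * exact zero_first_eigenfunction.
    * intros x _; simpl; ring.
    * exact zero_adjoint_eigenfunction.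
    * intros x _; reflexivity.
  + split; [lra|]; destruct (even_eigenpair 0 l Hl Hc) as [P [Q _]].
    destruct Hbc; subst bc; eexists; [exact P | exact Q].
Qed.

Lemma odd_eigenvalue_iff (bc : list nat) (l : R) : bc = first_bc \/ bc = adjoint_bc ->
  odd_eigenvalue bc l <-> 0 < l /\ sin l = 0.
Proof.
intros Hbc; split.
- intros Hev; pose proof Hev as [[Hl|Hl] [f [Hf He]]];
    [split; [exact Hl|] | subst l; destruct (zero_not_odd_eigenvalue bc Hbc Hev)].
  apply NNPP; intros Hc.
  assert (He' : forall x, -1 <= x <= 1 -> f (- x) = -1 * f x)
    by (intros x Hx; rewrite He by exact Hx; ring).
  pose proof (sinh_half_pos l Hl) as S_pos.
  (* The odd solutions cos sinh and sin cosh; here the sum of squares is c^2 + S^2. *)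
  set (m1 := Coords 0 0 0 0 1 0); set (m2 := Coords 0 0 0 0 0 1).
  assert (v2 : wave (Nat.iter 2 shift (odd_phi l)) l <> 0).
  { rewrite odd_phi_2 by exact Hl; rewrite sin_half in Hc; intros Z; apply Hc.
    assert (N : 0 < sin (l / 2) ^ 2 + sinh (sqrt 3 * l / 2) ^ 2) by nra.
    assert (M : 0 < cos (l / 2) ^ 2 + sinh (sqrt 3 * l / 2) ^ 2) by nra.
    half_variables l.
    apply (Rmult_eq_reg_r (- (s ^ 2 + S ^ 2) / (c ^ 2 + S ^ 2))).
    - rewrite Rmult_0_l, <- Z; field; lra.
    - unfold Rdiv; apply Rmult_integral_contrapositive; split; [lra | apply Rinv_neq_0_compat; lra]. }
  assert (m13 : wave (Nat.iter 3 shift m1) l =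
    (wave (Nat.iter 1 shift m1) l - sqrt 3 * wave (Nat.iter 1 shift m2) l) / 2)
    by (unfold wave; simpl; field [sqrt3_sqr]).
  assert (m23 : wave (Nat.iter 3 shift m2) l =
    (wave (Nat.iter 1 shift m2) l + sqrt 3 * wave (Nat.iter 1 shift m1) l) / 2)
    by (unfold wave; simpl; field [sqrt3_sqr]).
  assert (m12 : 0 < wave (Nat.iter 1 shift m1) l ^ 2 + wave (Nat.iter 1 shift m2) l ^ 2).
  { rewrite !wave_half; simpl Nat.iter; cbn [c1 c2 c3 c4 c5 c6 shift m1 m2].
    half_variables l.
    replace (_ + _) with (c ^ 2 + S ^ 2); [nra | field [w2 C2 c2']]. }
  assert (P1 : reflect m1 = scale (-1) m1) by (apply coords_eq; simpl; ring).
  assert (P2 : reflect m2 = scale (-1) m2) by (apply coords_eq; simpl; ring).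
  destruct Hbc; subst bc; revert Hf;
    [apply (first_problem_nonexistence (-1) l f (odd_phi l) m1 m2)
    |apply (adjoint_problem_nonexistence (-1) l f (odd_phi l) m1 m2)];
    auto using odd_phi_parity, odd_phi_1, odd_phi_3; ring.
- intros [Hl Hs]; split; [lra|]; destruct (odd_eigenpair l Hl Hs) as [P [Q _]].
  destruct Hbc; subst bc; eexists; [exact P | exact Q].
Qed.

Lemma c_const_0 (l : R) : c_const 0 l = 16 / 15.
Proof.
apply (is_RInt_unique (V := R_CompleteNormedModule)).
set (F := fun x : R => x ^ 5 / 5 - 2 / 3 * x ^ 3 + x).
replace (16 / 15) with (minus (F 1) (F (-1)))
  by (unfold F, minus, plus, opp; simpl; field).
apply (is_RInt_derive (V := R_CompleteNormedModule)).
- intros x _; unfold F; auto_derive; [exact I | field].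
- intros x _; apply (ex_derive_continuous (V := R_NormedModule)); auto_derive; exact I.
Qed.

Theorem proposition3p5 (lamc lams muc mus : nat -> R)
  (hlamc : increasing_enumeration 0 (even_eigenvalue first_bc) lamc)
  (hlams : increasing_enumeration 1 (odd_eigenvalue first_bc) lams)
  (hmuc : increasing_enumeration 0 (even_eigenvalue adjoint_bc) muc)
  (hmus : increasing_enumeration 1 (odd_eigenvalue adjoint_bc) mus) :
  (forall l : nat, lamc l = muc l) /\
  (forall l : nat, (1 <= l)%nat -> lams l = mus l) /\
  (forall l : nat,
     (is_eigenfunction first_bc (lamc l) (psi_c l (lamc l)) /\
      even_function (psi_c l (lamc l))) /\
     (is_eigenfunction adjoint_bc (muc l) (phi_c l (muc l)) /\
      even_function (phi_c l (muc l)))) /\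
  (forall l : nat, (1 <= l)%nat ->
     (is_eigenfunction first_bc (lams l) (psi_s (lams l)) /\
      odd_function (psi_s (lams l))) /\
     (is_eigenfunction adjoint_bc (mus l) (phi_s (mus l)) /\
      odd_function (phi_s (mus l)))) /\
  (forall l m : nat, l <> m ->
     inner (psi_c l (lamc l)) (phi_c m (muc m)) = 0) /\
  (forall m : nat,
     inner (psi_c m (lamc m)) (phi_c m (muc m)) = c_const m (lamc m) /\
     c_const m (lamc m) <> 0) /\
  c_const 0 (lamc 0%nat) = 16 / 15 /\
  (forall l m : nat, (1 <= l)%nat -> (1 <= m)%nat -> l <> m ->
     inner (psi_s (lams l)) (phi_s (mus m)) = 0) /\
  (forall m : nat, (1 <= m)%nat ->
     inner (psi_s (lams m)) (phi_s (mus m)) = s_const (lams m) /\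
     s_const (lams m) <> 0).
Proof.
pose proof (fun x => even_eigenvalue_iff first_bc x (or_introl eq_refl)) as F_even.
pose proof (fun x => even_eigenvalue_iff adjoint_bc x (or_intror eq_refl)) as A_even.
pose proof (fun x => odd_eigenvalue_iff first_bc x (or_introl eq_refl)) as F_odd.
pose proof (fun x => odd_eigenvalue_iff adjoint_bc x (or_intror eq_refl)) as A_odd.
assert (Ec : forall l, lamc l = muc l).
{ intros l.
  apply (increasing_enumeration_unique 0 _ _ lamc muc
           (fun x => iff_trans (F_even x) (iff_sym (A_even x)))); auto; lia. }
assert (Es : forall l, (1 <= l)%nat -> lams l = mus l)
  by exact (increasing_enumeration_unique 1 _ _ lams mus
              (fun x => iff_trans (F_odd x) (iff_sym (A_odd x))) hlams hmus).
destruct hlamc as [incc valc]; destruct hlams as [incs vals].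
assert (nonneg : forall m, 0 <= lamc m) by (intros m; apply (valc (lamc m)); eauto using Nat.le_0_l).
(* Zero is an even eigenvalue and none is negative, so the enumeration starts with it, matching the
   separate branch of [psi_c] and [phi_c] at index 0. *)
assert (zero : lamc 0%nat = 0).
{ destruct (proj1 (valc 0)) as [[|m] [_ E]]; [apply F_even; auto | exact E |].
  pose proof (incc 0%nat (S m) ltac:(lia) ltac:(lia)); pose proof (nonneg 0%nat); lra. }
(* Later eigenvalues exceed the first one, hence are positive roots. *)
assert (charc : forall m, 0 < lamc (S m) /\ even_characteristic (lamc (S m)) = 0).
{ intros m; pose proof (incc 0%nat (S m) ltac:(lia) ltac:(lia)) as H.
  destruct (proj1 (F_even (lamc (S m)))) as [Z|Z]; [|lra | exact Z].
  apply valc; exists (S m); split; [lia | reflexivity]. }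
assert (chars : forall m, (1 <= m)%nat -> 0 < lams m /\ sin (lams m) = 0)
  by (intros m Hm; apply F_odd, vals; exists m; auto).
assert (distinct : forall k0 (u : nat -> R),
  (forall l m, (k0 <= l)%nat -> (l < m)%nat -> u l < u m) ->
  forall l m, (k0 <= l)%nat -> (k0 <= m)%nat -> l <> m -> u l <> u m).
{ intros k0 u Hu l m Hl Hm Hlm; destruct (Nat.lt_gt_cases l m) as [[h|h] _]; auto.
  - pose proof (Hu l m Hl h); lra.
  - pose proof (Hu m l Hm h); lra. }
assert (eigc : forall l,
  (is_eigenfunction first_bc (lamc l) (psi_c l (lamc l)) /\ even_function (psi_c l (lamc l))) /\
  (is_eigenfunction adjoint_bc (lamc l) (phi_c l (lamc l)) /\ even_function (phi_c l (lamc l))) /\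
  inner (psi_c l (lamc l)) (phi_c l (lamc l)) = c_const l (lamc l) /\ c_const l (lamc l) <> 0).
{ intros [|m].
  - rewrite zero; split; [|split; [|split]].
    + split; [exact zero_first_eigenfunction | intros x _; simpl; ring].
    + split; [exact zero_adjoint_eigenfunction | intros x _; reflexivity].
    + apply RInt_ext; intros x _; simpl; ring.
    + rewrite c_const_0; lra.
  - apply even_eigenpair; apply charc. }
assert (eigs : forall l, (1 <= l)%nat ->
  (is_eigenfunction first_bc (lams l) (psi_s (lams l)) /\ odd_function (psi_s (lams l))) /\
  (is_eigenfunction adjoint_bc (lams l) (phi_s (lams l)) /\ odd_function (phi_s (lams l))) /\
  inner (psi_s (lams l)) (phi_s (lams l)) = s_const (lams l) /\ s_const (lams l) <> 0)
  by (intros l Hl; apply odd_eigenpair; apply chars, Hl).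
split; [exact Ec|]; split; [exact Es|].
split; [|split; [|split; [|split; [|split; [|split]]]]].
- intros l; rewrite <- Ec; destruct (eigc l) as [P [Q _]]; exact (conj P Q).
- intros l Hl; rewrite <- Es by exact Hl; destruct (eigs l Hl) as [P [Q _]]; exact (conj P Q).
- intros l m Hlm; rewrite <- Ec.
  destruct (eigc l) as [[P _] _], (eigc m) as [_ [[Q _] _]].
  apply (eigenfunction_orthogonal _ _ _ _ P Q); auto.
  apply (distinct 0%nat lamc incc); auto; lia.
- intros m; rewrite <- Ec; apply (eigc m).
- apply c_const_0.
- intros l m Hl Hm Hlm; rewrite <- Es by exact Hm.
  destruct (eigs l Hl) as [[P _] _], (eigs m Hm) as [_ [[Q _] _]].
  apply (eigenfunction_orthogonal _ _ _ _ P Q); try (left; apply chars; assumption).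
  apply (distinct 1%nat lams incs); assumption.
- intros m Hm; rewrite <- Es by exact Hm; apply (eigs m Hm).
Qed.
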